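(* There is a universal constant $C>0$ such that the following holds. Let $\delta\in(0,1)$ and let $X\sim N(0,\Sigma)$ be a $\kappa$-nondegenerate (not necessarily attractive) Gaussian graphical model on $n$ nodes with maximum degree $d$. If the number of i.i.d. samples satisfies $m\ge C\left(\frac{d\log(n)}{\kappa^2}+\frac{\log(2/\delta)}{\kappa^2}\right)$, then with probability at least $1-\delta$, for every node $i$ the algorithm \textsc{SearchAndValidate}$(i,d,\nu)$ with $\nu=\kappa^2/2$ returns exactly the set of neighbors of $i$.
   Context: A Gaussian graphical model (GGM) on $n$ nodes is a Gaussian vector $X=(X_1,\dots,X_n)\sim N(0,\Sigma)$ with invertible covariance $\Sigma$ and precision matrix $\Theta=\Sigma^{-1}$. Its graph has vertex set $\{1,\dots,n\}$, with distinct $i,j$ adjacent (neighbors) iff $\Theta_{ij}\neq0$. For $\kappa\in(0,1]$, the GGM is $\kappa$-nondegenerate if $|\Theta_{ij}|/\sqrt{\Theta_{ii}\Theta_{jj}}\ge\kappa$ for all $i\ne j$ with $\Theta_{ij}\ne0$. (It is called attractive if $\Theta_{ij}\le0$ for all $i\neq j$; this is not assumed here.) The $m$ samples are split into two equally sized sample sets 1 and 2. $\hat{\mathbb E}_1$ denotes the empirical expectation over sample set 1. $\widehat{\mathrm{Var}}_2(X_i\mid X_S)$ denotes the ordinary least squares estimate of the conditional variance computed from sample set 2: if set 2 has $m_2$ samples forming the rows of the matrix $\mathbb X$ with columns $\mathbb X_k$, it equals $\frac{1}{m_2-|S|}\min_{w:\,\mathrm{supp}(w)\subset S}\|\mathbb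 X_i-\mathbb Xw\|_2^2$. \textsc{SearchAndValidate}$(i,d,\nu)$: (1) For each $d'=0,\dots,d$, let $w_{d'}$ be a minimizer of $\hat{\mathbb E}_1[(X_i-w\cdot X)^2]$ over $w\in\mathbb R^n$ with $w_i=0$ and $|\mathrm{supp}(w)|\le d'$. (2) For $d'=0,1,\dots,d$ (outer loop): for each $d''\in\{0,\dots,d\}\setminus\{d'\}$, let $S_{d',d''}=\mathrm{supp}(w_{d'})\cup\mathrm{supp}(w_{d''})$; if for some $j\in\mathrm{supp}(w_{d''})\setminus\mathrm{supp}(w_{d'})$ we have $\widehat{\mathrm{Var}}_2(X_i\mid X_{S_{d',d''}\setminus\{j\}})-\widehat{\mathrm{Var}}_2(X_i\mid X_{S_{d',d''}})>\nu\,\widehat{\mathrm{Var}}_2(X_i\mid X_{S_{d',d''}})$, go on to the next value of $d'$ in the outer loop. If this happens for no $d''$, stop and return $\mathrm{supp}(w_{d'})$. *)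

(* Defs.v *)
From HB Require Import structures.
From mathcomp Require Import all_boot all_order all_algebra.
From mathcomp Require Import all_classical all_reals all_analysis.

Set Implicit Arguments.
Unset Strict Implicit.
Unset Printing Implicit Defensive.

Import Order.TTheory GRing.Theory Num.Theory.
Import numFieldNormedType.Exports.

Local Open Scope classical_set_scope.
Local Open Scope ring_scope.

Definition mutually_independent (d d' : measure_display)
    (T : measurableType d) (U : measurableType d') (R : realType)
    (P : probability T R) (I : finType) (X : I -> {RV P >-> U}) : Prop :=
  forall B : I -> set U, (forall i, measurable (B i)) ->
    P (\bigcap_(i in [set: I]) (X i @^-1` B i)) =
    (\prod_(i : I) P (X i @^-1` B i))%E.

Definition standard_normal (d : measure_display) (T : measurableType d)
    (R : realType) (P : probability T R) (Z : {RV P >-> R}) : Prop :=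
  forall B : set R, measurable B -> distribution P Z B = normal_prob 0 1 B.

(* X ~ N(0, Sigma): X = A Z with A A^T = Sigma and the entries of Z independent
   standard normals.  When Sigma is invertible so is A, hence Z = A^-1 X and
   asking for Z on the same probability space is no restriction. *)
Definition gaussian_vector (d : measure_display) (T : measurableType d)
    (R : realType) (P : probability T R) (n : nat)
    (X : {RV P >-> n.-tuple R}) (Sigma : 'M[R]_n) : Prop :=
  exists (A : 'M[R]_n) (Z : 'I_n -> {RV P >-> R}),
    [/\ A *m A^T = Sigma,
        forall j, standard_normal (Z j),
        mutually_independent Z
      & forall (omega : T) (j : 'I_n),
          tnth (X omega) j = \sum_(l < n) A j l * Z l omega].

Definition neighbors (R : realType) (n : nat) (Theta : 'M[R]_n) (i : 'I_n) :
    {set 'I_n} :=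
  [set j | (j != i) && (Theta i j != 0)]%SET.

Definition max_degree (R : realType) (n : nat) (Theta : 'M[R]_n) : nat :=
  (\max_(i < n) #|neighbors Theta i|)%N.

Definition kappa_nondegenerate (R : realType) (n : nat) (kappa : R)
    (Theta : 'M[R]_n) : Prop :=
  forall i j : 'I_n, i != j -> Theta i j != 0 ->
    kappa <= `|Theta i j| / Num.sqrt (Theta i i * Theta j j).

(* In the following, the rows of D : 'M_(k, n) are the k samples of a sample
   set, and regression weights are column vectors. *)

Definition supp (R : realType) (n : nat) (w : 'cV[R]_n) : {set 'I_n} :=
  [set j | w j 0 != 0]%SET.

Definition rss (R : realType) (k n : nat) (D : 'M[R]_(k, n)) (i : 'I_n)
    (w : 'cV[R]_n) : R :=
  \sum_(r < k) (D r i - (D *m w) r 0) ^+ 2.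

Definition empirical_risk (R : realType) (k n : nat) (D : 'M[R]_(k, n))
    (i : 'I_n) (w : 'cV[R]_n) : R :=
  k%:R^-1 * rss D i w.

(* The infimum is a minimum: least squares over a linear subspace. *)
Definition ols_var (R : realType) (k n : nat) (D : 'M[R]_(k, n)) (i : 'I_n)
    (S : {set 'I_n}) : R :=
  (k%:R - #|S|%:R)^-1 *
  inf [set rss D i w | w in [set w : 'cV[R]_n | supp w \subset S]].

Definition feasible (R : realType) (n : nat) (i : 'I_n) (s : nat)
    (w : 'cV[R]_n) : Prop :=
  w i 0 = 0 /\ (#|supp w| <= s)%N.

Definition best_subset (R : realType) (k n : nat) (D : 'M[R]_(k, n))
    (i : 'I_n) (s : nat) (w : 'cV[R]_n) : Prop :=
  feasible i s w /\
  forall v, feasible i s v -> empirical_risk D i w <= empirical_risk D i v.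

Definition rejected (R : realType) (k n : nat) (D : 'M[R]_(k, n)) (i : 'I_n)
    (deg : nat) (nu : R) (w : 'I_deg.+1 -> 'cV[R]_n) (d1 : 'I_deg.+1) : bool :=
  [exists d2 : 'I_deg.+1, (d2 != d1) &&
    [exists j : 'I_n, (j \in supp (w d2) :\: supp (w d1)) &&
      (let S := supp (w d1) :|: supp (w d2) in
       ols_var D i (S :\ j) - ols_var D i S > nu * ols_var D i S)]].

(* The support of w_{d1} for the first d1 that is not rejected; None if every
   d1 is rejected (ordinals are enumerated increasingly). *)
Definition validate (R : realType) (k n : nat) (D : 'M[R]_(k, n)) (i : 'I_n)
    (deg : nat) (nu : R) (w : 'I_deg.+1 -> 'cV[R]_n) : option {set 'I_n} :=
  ohead [seq supp (w d1) | d1 <- enum 'I_deg.+1 & ~~ rejected D i nu w d1].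

(* The algorithm may pick any minimizers in its first phase, so it is a
   relation between the data and the possible outputs. *)
Definition search_and_validate (R : realType) (k1 k2 n : nat)
    (D1 : 'M[R]_(k1, n)) (D2 : 'M[R]_(k2, n)) (i : 'I_n) (deg : nat) (nu : R)
    (out : option {set 'I_n}) : Prop :=
  exists w : 'I_deg.+1 -> 'cV[R]_n,
    (forall s : 'I_deg.+1, best_subset D1 i s (w s)) /\
    out = validate D2 i nu w.

Definition sample_set1 (R : realType) (k n : nat)
    (x : 'I_(k + k) -> n.-tuple R) : 'M[R]_(k, n) :=
  \matrix_(r < k, j < n) tnth (x (lshift k r)) j.

Definition sample_set2 (R : realType) (k n : nat)
    (x : 'I_(k + k) -> n.-tuple R) : 'M[R]_(k, n) :=
  \matrix_(r < k, j < n) tnth (x (rshift k r)) j.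

(* Main.v *)
(* Everything the algorithm computes is controlled by a restricted isometry: on
   vectors supported on at most 2d+1 coordinates, the empirical second moment of
   each half of the data agrees with Sigma up to a factor 1 +- kappa/20.  Let
   u = Theta e_i / Theta_ii = e_i - w* be the direction of the regression residual.
   It is Sigma-orthogonal to every v with v_i = 0, so the empirical risk of w* - v
   exceeds that of w* by about the squared Sigma-norm of v, the cross term being of
   relative size kappa.  Leaving out a neighbor j forces v_j = w*_j, and
   Cauchy-Schwarz against Theta e_j then makes the squared norm of v at least
   kappa^2 / Theta_ii, which beats the error kappa^2 / (20 Theta_ii).

   The isometry follows from a union bound over supports and over a lattice net of
   a Sigma-orthonormal basis, and from the chi-square tail for a fixed direction.
   Only the moment generating function of a Gaussian linear form is used for the
   tail, so that independence enters through products alone. *)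

Require Import Defs.
From HB Require Import structures.
From mathcomp Require Import all_boot all_order all_algebra.
From mathcomp Require Import all_classical all_reals all_analysis.
From mathcomp Require Import measurable_realfun.
From mathcomp Require Import ring lra.

Set Implicit Arguments.
Unset Strict Implicit.
Unset Printing Implicit Defensive.

Import Order.TTheory GRing.Theory Num.Theory.
Import numFieldNormedType.Exports.

Local Open Scope classical_set_scope.
Local Open Scope ring_scope.

(** * Independence *)

Section integral_density.
Local Open Scope ereal_scope.
Import HBNNSimple.

(** Change of variables: by hypothesis [nu] is the image under [phi] of the measure with density
    [g]. The identity passes from indicators to simple functions, and to [f] by monotone
    convergence. *)
Lemma ge0_integral_density (R : realType) (d1 d2 : measure_display)
    (T1 : measurableType d1) (T2 : measurableType d2)
    (mu : {measure set T1 -> \bar R}) (nu : {measure set T2 -> \bar R})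
    (phi : T1 -> T2) (g : T1 -> R) :
  measurable_fun setT phi -> measurable_fun setT g -> (forall x, (0 <= g x)%R) ->
  (forall B, measurable B -> \int[mu]_(x in phi @^-1` B) (g x)%:E = nu B) ->
  forall f : T2 -> R, measurable_fun setT f -> (forall y, (0 <= f y)%R) ->
  \int[mu]_x (f (phi x) * g x)%:E = \int[nu]_y (f y)%:E.
Proof.
move=> mphi mg g0 muE f mf f0.
have mfE : measurable_fun [set: T2] (fun y => (f y)%:E) by exact/measurable_EFinP.
pose h := nnsfun_approx measurableT mfE.
have hf y : (h n y)%:E @[n --> \oo] --> (f y)%:E.
  by apply: (@cvg_nnsfun_approx _ _ _ _ measurableT _ mfE) => // z _; rewrite lee_fin.
have hphi n : measurable_fun [set: T1] (h n \o phi).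
  by apply: (measurableT_comp _ mphi).
have -> : \int[nu]_y (f y)%:E = lim (\int[nu]_y (h n y)%:E @[n --> \oo]).
  rewrite -monotone_convergence//.
  - by apply: eq_integral => y _; apply/esym/cvg_lim.
  - by move=> n; exact/measurable_EFinP.
  - by move=> n y _; rewrite lee_fin.
  - by move=> y _ a b ab; rewrite lee_fin; exact/lefP/nd_nnsfun_approx.
have -> : \int[mu]_x (f (phi x) * g x)%:E =
    lim (\int[mu]_x (h n (phi x) * g x)%:E @[n --> \oo]).
  rewrite -monotone_convergence//.
  - apply: eq_integral => x _; apply/esym/cvg_lim => //.
    rewrite EFinM; under eq_fun do rewrite EFinM.
    by apply: (cvgeZr _ (hf _)).
  - by move=> n; apply/measurable_EFinP; apply: (measurable_funM (hphi n) mg).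
  - by move=> n x _; rewrite lee_fin mulr_ge0.
  - move=> x _ a b ab; rewrite lee_fin ler_wpM2r//.
    exact/lefP/nd_nnsfun_approx.
suff suf n : \int[mu]_x (h n (phi x) * g x)%:E = \int[nu]_y (h n y)%:E.
  by under eq_fun do rewrite suf.
transitivity (\int[nu]_y (\sum_(r \in range (h n)) (r * \1_(h n @^-1` [set r]) y)%:E)); last first.
  by apply: eq_integral => y _; rewrite fsumEFin// -fimfunE.
rewrite ge0_integral_fsum//; last 2 first.
- by move=> r; apply/measurable_EFinP; exact: measurable_funM.
- by move=> r y _; exact: nnfun_muleindic_ge0.
transitivity (\int[mu]_x (\sum_(r \in range (h n))
    (r * \1_(h n @^-1` [set r]) (phi x))%:E * (g x)%:E)).
  apply: eq_integral => x _.
  rewrite -ge0_mule_fsuml => [|y]; last exact: nnfun_muleindic_ge0.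
  by rewrite fsumEFin // -(fimfunE _ (phi x)).
rewrite ge0_integral_fsum//; last 2 first.
- move=> r; apply: emeasurable_funM; last exact/measurable_EFinP.
  apply/measurable_EFinP/measurable_funM => //.
  by apply: (measurableT_comp _ mphi).
- by move=> r y _; rewrite mule_ge0// ?lee_fin//; exact: nnfun_muleindic_ge0.
apply: eq_fsbigr => r rhn.
have r0 : (0 <= r)%R by move: rhn; rewrite inE => -[t _ <-].
under eq_integral do rewrite EFinM -muleA.
under [RHS]eq_integral do rewrite EFinM.
have mind : measurable_fun [set: T1] (fun x => (\1_(h n @^-1` [set r]) (phi x))%:E : \bar R).
  by apply/measurable_EFinP; apply: (measurableT_comp _ mphi).
rewrite !ge0_integralZl//.
- rewrite integral_indic// setIT -muE//.
  congr (_ * _); rewrite [RHS]integral_mkcond.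
  apply: eq_integral => x _; rewrite patchE indicE/=.
  have -> : (x \in phi @^-1` (h n @^-1` [set r])) = (phi x \in h n @^-1` [set r]).
    by apply/idP/idP; rewrite !inE.
  by case: ifP => _; rewrite ?mul1e ?mul0e.
- by apply: emeasurable_funM => //; exact/measurable_EFinP.
- by move=> *; rewrite mule_ge0 ?lee_fin.
- exact/measurable_EFinP.
Qed.

End integral_density.

Section independence.
Local Open Scope ereal_scope.

Lemma expectation_prod_indep (R : realType) (d d' : measure_display)
    (T : measurableType d) (U : measurableType d') (P : probability T R)
    (I : finType) (X : I -> {RV P >-> U}) (f : I -> U -> R) :
  mutually_independent X ->
  (forall i, measurable_fun setT (f i)) -> (forall i u, (0 <= f i u)%R) ->
  (forall i, \int[P]_w (f i (X i w))%:E < +oo) ->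
  \int[P]_w (\prod_i f i (X i w))%:E = \prod_i \int[P]_w (f i (X i w))%:E.
Proof.
move=> indX.
suff H (s : seq I) : forall f : I -> U -> R,
    (forall i, i \notin s -> exists2 B, measurable B & f i = \1_B) ->
    (forall i, measurable_fun setT (f i)) -> (forall i u, (0 <= f i u)%R) ->
    (forall i, \int[P]_w (f i (X i w))%:E < +oo) ->
    \int[P]_w (\prod_i f i (X i w))%:E = \prod_i \int[P]_w (f i (X i w))%:E.
  by apply: (H (enum I)) => i; rewrite mem_enum.
(* The hypothesis is the case of indicators; these are exchanged for the
   actual functions one index at a time. *)
elim: s => [|i0 s IH] {}f fs mf f0 foo.
  have /choice[B BP] : forall i, exists B, measurable B /\ f i = \1_B.
    by move=> i; have [//|B] := fs i; exists B.
  have mB i : measurable (B i) by case: (BP i).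
  have mXB i : measurable (X i @^-1` B i) by exact: measurable_funPTI.
  transitivity (P (\bigcap_(i in [set: I]) (X i @^-1` B i))).
    rewrite -[in RHS](setIT (\bigcap_(_ in _) _)) -integral_indic//; last first.
      by apply: fin_bigcap_measurable => //; exact: finite_finset.
    apply: eq_integral => w _; congr (_%:E).
    under eq_bigr do rewrite (BP _).2 indicE.
    rewrite indicE; case: (boolP (w \in _)).
      rewrite inE => H; rewrite big1// => i _; rewrite mem_set//; exact: H.
    move=> /negP H; apply/eqP; rewrite prodf_seq_eq0; apply: contrapT => /negP/hasPn K.
    apply: H; rewrite inE => i _ /=.
    have := K i; rewrite mem_index_enum => /(_ isT).
    by case: (boolP (_ \in _)) => [|_]; [rewrite inE|rewrite eqxx].
  rewrite (indX _ mB); apply: eq_bigr => i _.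
  rewrite -[in LHS](setIT (_ @^-1` _)) -integral_indic//.
  by apply: eq_integral => w _; rewrite (BP i).2 !indicE; congr (_%:R%:E); apply/idP/idP; rewrite !inE.
have mfX i : measurable_fun [set: T] (fun w => f i (X i w)) by apply: measurableT_comp.
pose c := (\prod_(i | i != i0) fine (\int[P]_w (f i (X i w))%:E))%R.
have c0 : (0 <= c)%R.
  by apply: prodr_ge0 => i _; apply: fine_ge0; apply: integral_ge0 => w _; rewrite lee_fin.
have fin i : \int[P]_w (f i (X i w))%:E \is a fin_num.
  by rewrite ge0_fin_numE//; apply: integral_ge0 => w _; rewrite lee_fin.
have cE : \prod_(i | i != i0) \int[P]_w (f i (X i w))%:E = c%:E.
  rewrite /c -prodEFin; apply: eq_bigr => i _; by rewrite fineK.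
rewrite [RHS](bigD1 i0)//= cE muleC.
under eq_integral do rewrite (bigD1 i0)//=.
(* The other factors act as a density: the image of this weighted measure under [X i0] is the law of
   [X i0] scaled by [c], which is the induction hypothesis with an indicator in place of [f i0]. *)
pose g w := (\prod_(i | i != i0) f i (X i w))%R.
have -> := @ge0_integral_density R _ _ T U P (mscale (NngNum c0) (distribution P (X i0)))
  (X i0) g _ _ _ _ (f i0) (mf i0) (f0 i0).
- rewrite ge0_integral_mscale//=; last 2 first.
  + exact/measurable_EFinP.
  + by move=> *; rewrite lee_fin.
  rewrite ge0_integral_distribution//; first exact/measurable_EFinP.
  by move=> y; rewrite lee_fin.
- by [].
- rewrite /g; under eq_fun do rewrite big_mkcond/=.
  by apply: measurable_prod => i _; case: (i != i0).
- by move=> w; apply: prodr_ge0.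
move=> B mB; pose f' := fun i => if i == i0 then \1_B else f i.
have f'i i : i != i0 -> f' i = f i by rewrite /f' => /negbTE ->.
have f'i0 : f' i0 = \1_B by rewrite /f' eqxx.
have mXB : measurable (X i0 @^-1` B) by exact: measurable_funPTI.
have EB : \int[P]_w (f' i0 (X i0 w))%:E = P (X i0 @^-1` B).
  by rewrite f'i0 -[in RHS](setIT (_ @^-1` _)) -integral_indic//.
transitivity (\prod_i \int[P]_w (f' i (X i w))%:E); last first.
  rewrite (bigD1 i0)//= EB (eq_bigr (fun i => \int[P]_w (f i (X i w))%:E)).
    by rewrite cE muleC.
  by move=> i /f'i ->.
rewrite -IH.
- rewrite integral_mkcond; apply: eq_integral => w _.
  rewrite patchE (bigD1 i0)//= f'i0 (eq_bigr (fun i => f i (X i w))); last first.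
    by move=> i /f'i ->.
  rewrite -/(g w) indicE.
  have -> : (w \in X i0 @^-1` B) = (X i0 w \in B) by apply/idP/idP; rewrite !inE.
  by case: ifP => _; rewrite ?mul1r ?mul0r.
- move=> i si; have [->|ii0] := eqVneq i i0; first by exists B; rewrite ?f'i0.
  by rewrite f'i//; apply: fs; rewrite inE negb_or ii0.
- by move=> i; rewrite /f'; case: ifP.
- by move=> i u; rewrite /f'; case: ifP => _.
- move=> i; have [->|ii0] := eqVneq i i0; last by rewrite f'i.
  by rewrite EB (le_lt_trans (probability_le1 _ _))// ltry.
Qed.

End independence.

(** * Gaussian integrals and chi-square tails *)

Section standard_normal_integrals.
Local Open Scope ereal_scope.
Context {R : realType}.
Local Notation mu := (@lebesgue_measure R).

Lemma integral_standard_normal (d : measure_display) (T : measurableType d)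
    (P : probability T R) (Z : {RV P >-> R}) (f : R -> R) :
  standard_normal Z -> measurable_fun setT f -> (forall x, (0 <= f x)%R) ->
  \int[P]_w (f (Z w))%:E = \int[mu]_x (f x * normal_pdf 0 1 x)%:E.
Proof.
move=> nZ mf f0.
rewrite -[LHS](@ge0_integral_distribution _ _ _ _ R P Z (EFin \o f)); last 2 first.
- exact/measurable_EFinP.
- by move=> y; rewrite lee_fin.
apply/esym.
apply: (@ge0_integral_density R _ _ _ _ mu (distribution P Z) idfun (normal_pdf 0 1)) => //.
- exact: measurable_id.
- exact: measurable_normal_pdf.
- by move=> x; exact: normal_pdf_ge0.
- by move=> B mB; apply: esym; apply: nZ.
Qed.

(** Completing the square turns the integrand into [expR (t ^+ 2 / 2)] times the density of N(t,
    1). *)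
Lemma normal01_mgf (t : R) :
  \int[mu]_x (expR (t * x) * normal_pdf 0 1 x)%:E = (expR (t ^+ 2 / 2))%:E.
Proof.
transitivity (\int[mu]_x ((expR (t ^+ 2 / 2))%:E * (normal_pdf t 1 x)%:E)).
  apply: eq_integral => x _; rewrite -EFinM; congr (_%:E).
  rewrite !normal_pdfE ?oner_eq0// /normal_fun.
  rewrite mulrCA [RHS]mulrCA -!expRD; congr (_ * expR _)%R.
  by rewrite expr1n; lra.
rewrite ge0_integralZl//; last 2 first.
- by apply/measurable_EFinP; exact: measurable_normal_pdf.
- by move=> x _; rewrite lee_fin normal_pdf_ge0.
by rewrite integral_normal_pdf mule1.
Qed.

(** The integrand is [s^-1] times the centered normal density of standard deviation [s^-1], where
    [s ^+ 2 = 1 - 2 * a]. *)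
Lemma normal01_expR_sqr (a : R) : (a < 2^-1)%R ->
  \int[mu]_x (expR (a * x ^+ 2) * normal_pdf 0 1 x)%:E = ((Num.sqrt (1 - 2 * a))^-1)%:E.
Proof.
move=> a1; have b0 : (0 < 1 - 2 * a)%R by lra.
set s := Num.sqrt (1 - 2 * a).
have s0 : (0 < s)%R by rewrite sqrtr_gt0.
have s2 : (s ^+ 2 = 1 - 2 * a)%R by rewrite sqr_sqrtr// ltW.
transitivity (\int[mu]_x (s^-1%:E * (normal_pdf 0 s^-1 x)%:E)).
  apply: eq_integral => x _; rewrite -EFinM; congr (_%:E).
  rewrite !normal_pdfE ?oner_eq0// ?invr_eq0 ?gt_eqF// /normal_fun /normal_peak.
  have -> : (Num.sqrt (s^-1 ^+ 2 * pi *+ 2) = s^-1 * Num.sqrt (1 ^+ 2 * pi *+ 2))%R.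
    by rewrite -2!mulrnAr sqrtrM ?sqr_ge0// sqrtr_sqr ger0_norm ?invr_ge0 ?ltW// expr1n mul1r.
  rewrite [X in _ = (_ * (X * _))%R]invfM invrK -[in RHS]mulrA mulKf ?gt_eqF// mulrCA -expRD.
  congr (_ * expR _)%R.
  have -> : ((s^-1 ^+ 2 *+ 2)^-1 = (1 - 2 * a) / 2)%R.
    by rewrite -mulr_natr invfM exprVn invrK s2.
  by rewrite expr1n subr0; lra.
rewrite ge0_integralZl//; last 3 first.
- by apply/measurable_EFinP; exact: measurable_normal_pdf.
- by move=> x _; rewrite lee_fin normal_pdf_ge0.
- by rewrite lee_fin invr_ge0 ltW.
by rewrite integral_normal_pdf mule1.
Qed.

End standard_normal_integrals.

Section gaussian_linear_form.
Local Open Scope ereal_scope.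
Context {R : realType} (d : measure_display) (T : measurableType d)
  (P : probability T R) (n : nat).
Local Notation mu := (@lebesgue_measure R).

Lemma expectation_expR_linear (Z : 'I_n -> {RV P >-> R}) (c : 'I_n -> R) :
  (forall l, standard_normal (Z l)) -> mutually_independent Z ->
  \int[P]_w (expR (\sum_l c l * Z l w))%:E = (expR ((\sum_l c l ^+ 2) / 2))%:E.
Proof.
move=> nZ iZ.
have E l : \int[P]_w (expR (c l * Z l w))%:E = (expR (c l ^+ 2 / 2))%:E.
  rewrite (@integral_standard_normal _ _ _ P (Z l) (fun x => expR (c l * x)))//.
  - exact: normal01_mgf.
  - by apply: measurableT_comp => //; exact: measurable_funM.
under eq_integral do rewrite expR_sum.
rewrite (@expectation_prod_indep _ _ _ _ _ P _ Z (fun l x => expR (c l * x)))//.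
- under eq_bigr do rewrite E.
  by rewrite prodEFin -expR_sum -mulr_suml.
- by move=> l; apply: measurableT_comp => //; exact: measurable_funM.
- by move=> l; rewrite E ltry.
Qed.

Lemma expectation_expR_sqr_linear (Z : 'I_n -> {RV P >-> R}) (c : 'I_n -> R) (a : R) :
  (forall l, standard_normal (Z l)) -> mutually_independent Z ->
  (\sum_l c l ^+ 2 = 1)%R -> (0 <= a < 2^-1)%R ->
  \int[P]_w (expR (a * (\sum_l c l * Z l w) ^+ 2))%:E = ((Num.sqrt (1 - 2 * a))^-1)%:E.
Proof.
move=> nZ iZ c1 /andP[a0 a1].
pose Y w : R := (\sum_l c l * Z l w)%R.
pose t := Num.sqrt (2 * a).
have t2 : (t ^+ 2 = 2 * a)%R by rewrite sqr_sqrtr// mulr_ge0.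
have mY : measurable_fun [set: T] Y.
  by apply: measurable_sum => l; exact: measurable_funM.
(* With an independent standard normal g, exp (a Y^2) = E_g (exp (sqrt (2 a) g Y)). *)
pose F (z : T * measurableTypeR R) : \bar R :=
  (expR (t * Y z.1 * z.2) * normal_pdf 0 1 z.2)%:E.
have mF : measurable_fun setT F.
  apply/measurable_EFinP; apply: measurable_funM.
    apply: measurableT_comp => //.
    apply: measurable_funM => //; apply: measurable_funM => //.
    by apply: measurableT_comp.
  apply: measurableT_comp => //; exact: measurable_normal_pdf.
have F0 z : 0 <= F z by rewrite lee_fin mulr_ge0 ?expR_ge0 ?normal_pdf_ge0.
transitivity (\int[P]_w \int[mu]_g F (w, g)).
  apply: eq_integral => w _; rewrite /F/= normal01_mgf exprMn t2.
  by congr (expR _)%:E; rewrite -/(Y w); lra.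
rewrite fubini_tonelli// -(normal01_expR_sqr a1).
apply: eq_integral => g _.
have := @expectation_expR_linear Z (fun l => t * g * c l)%R nZ iZ.
under eq_bigr do rewrite exprMn.
rewrite -mulr_sumr c1 mulr1 exprMn t2 => H.
transitivity (\int[P]_w ((normal_pdf 0 1 g)%:E * (expR (\sum_l t * g * c l * Z l w))%:E)).
  apply: eq_integral => w _; rewrite /F/= /Y -EFinM mulrC; congr (_ * expR _)%:E.
  by rewrite mulrAC mulr_sumr; apply: eq_bigr => l _; rewrite mulrA.
rewrite ge0_integralZl//; last 2 first.
- apply/measurable_EFinP; apply: measurableT_comp => //.
  by apply: measurable_sum => l; exact: measurable_funM.
- by rewrite lee_fin normal_pdf_ge0.
by rewrite H -EFinM mulrC; congr (expR _ * _)%:E; lra.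
Qed.

End gaussian_linear_form.

(** * Chernoff bounds and the chi-square tail *)

Section chernoff_indep.
Local Open Scope ereal_scope.
Context {R : realType} (d d' : measure_display) (T : measurableType d)
  (U : measurableType d') (P : probability T R) (I : finType)
  (X : I -> {RV P >-> U}).
Hypothesis indX : mutually_independent X.

Let P_cst (c : R) : \int[P]_w c%:E = c%:E.
Proof. by rewrite integral_cst// [X in _ * X](probability_setT P) mule1. Qed.

Let measurable_sumX (J : pred I) (q : U -> R) : measurable_fun setT q ->
  measurable_fun [set: T] (fun w => \sum_(s | J s) q (X s w))%R.
Proof.
move=> mq; under eq_fun do rewrite big_mkcond/=.
by apply: measurable_sum => s; case: (J s) => //; apply: measurableT_comp.
Qed.

Lemma measurable_sum_ge0 (J : pred I) (q : U -> R) : measurable_fun setT q ->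
  measurable [set w | (0 <= \sum_(s | J s) q (X s w))%R].
Proof.
move=> mq; set A := [set w | _].
rewrite (_ : A = (fun w => \sum_(s | J s) q (X s w))%R @^-1` `[0%R, +oo[).
  by rewrite -[X in measurable X]setTI; apply: (measurable_sumX J mq).
by apply/seteqP; split => w /=; rewrite /A/= in_itv/= andbT.
Qed.

(** Markov's inequality for the exponential of the sum, whose expectation factors by
    independence. *)
Lemma chernoff_sum (J : pred I) (q : U -> R) (b : R) :
  measurable_fun setT q ->
  (forall s, \int[P]_w (expR (q (X s w)))%:E <= (expR b)%:E) ->
  P [set w | (0 <= \sum_(s | J s) q (X s w))%R] <= (expR (#|J|%:R * b))%:E.
Proof.
move=> mq qb; set A := [set w | _].
have mqX s : measurable_fun [set: T] (fun w => q (X s w)) by apply: measurableT_comp.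
have mA : measurable A by exact: measurable_sum_ge0.
(* Independence is stated for the full family, so indices outside [J] receive the constant factor
   1. *)
pose f s u := if J s then expR (q u) else 1%R.
have fE w : expR (\sum_(s | J s) q (X s w)) = (\prod_s f s (X s w))%R.
  by rewrite expR_sum big_mkcond.
apply: (@le_trans _ _ (\int[P]_w (\prod_s f s (X s w))%:E)).
  rewrite -[X in P X]setIT -integral_indic//.
  apply: ge0_le_integral => //.
  - by apply/measurable_EFinP; exact: measurable_indic.
  - apply/measurable_EFinP; under eq_fun do rewrite -fE.
    by apply: measurableT_comp => //; exact: measurable_sumX.
  - move=> w _; rewrite lee_fin -fE indicE; case: (boolP (w \in A)) => [|_].
      by rewrite inE /A/= => w0; rewrite -expR0 ler_expR.
    exact: expR_ge0.
rewrite expectation_prod_indep//.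
- rewrite (eq_bigr (fun s => if J s then \int[P]_w (expR (q (X s w)))%:E else 1)); last first.
    by move=> s _; rewrite /f; case: (J s) => //; exact: (P_cst 1).
  rewrite -big_mkcond/=.
  apply: (@le_trans _ _ (\prod_(s | J s) (expR b)%:E)).
    pose K (x z : \bar R) := 0 <= x /\ x <= z.
    suff [] : K (\prod_(s | J s) \int[P]_w (expR (q (X s w)))%:E)
        (\prod_(s | J s) (expR b)%:E) by [].
    apply: (big_ind2 K) => // [x1 x2 z1 z2 [? ?] [? ?]|s _].
      by split; [exact: mule_ge0|exact: lee_pmul].
    by split => //; apply: integral_ge0 => w _; rewrite lee_fin expR_ge0.
  by rewrite prodEFin prodr_const -expRM_natl.
- by move=> s; rewrite /f; case: (J s) => //; exact: measurableT_comp.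
- by move=> s u; rewrite /f; case: (J s).
- move=> s; rewrite /f; case: (J s).
    by rewrite (le_lt_trans (qb s))// ltry.
  by rewrite P_cst ltry.
Qed.

(** The chi-square law with one degree of freedom, seen only through its Laplace transform at
    nonnegative arguments: this is what [expectation_expR_sqr_linear] supplies, and it suffices for
    both tails. *)
Definition chi_square_one (y : U -> R) := forall s a, (0 <= a < 2^-1)%R ->
  \int[P]_w (expR (a * y (X s w) ^+ 2))%:E = ((Num.sqrt (1 - 2 * a))^-1)%:E.

Variable y : U -> R.
Hypothesis my : measurable_fun setT y.
Hypothesis y1 : chi_square_one y.

(** Squaring leaves [a ^+ 2] times a decreasing polynomial, whose value at [a = 1 / 5] is
    [2 - 7 / 5 - 3 / 20 - 1 / 10 > 0]. *)
Lemma invr_sqrt_le (a : R) : (0 <= a <= 5^-1)%R ->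
  ((Num.sqrt (1 - 2 * a))^-1 <= 1 + a + 5 / 2 * a ^+ 2)%R.
Proof.
move=> /andP[a0 a1].
have s0 : (0 < Num.sqrt (1 - 2 * a))%R by rewrite sqrtr_gt0; lra.
rewrite -[leLHS]mul1r ler_pdivrMr//.
rewrite -(@ler_pXn2r _ 2)//; last 2 first.
- by rewrite nnegrE ler01.
- by rewrite nnegrE mulr_ge0// ?sqrtr_ge0//; nra.
rewrite expr1n exprMn sqr_sqrtr; last by lra.
have a2 : (0 <= a ^+ 2)%R by rewrite sqr_ge0.
have E : ((1 + a + 5 / 2 * a ^+ 2) ^+ 2 * (1 - 2 * a) - 1 =
   a ^+ 2 * (2 - 7 * a - (15 / 4) * a ^+ 2 - (25 / 2) * a ^+ 3))%R by field.
rewrite -subr_ge0 E mulr_ge0//.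
have a22 : (a ^+ 2 <= 25^-1)%R by nra.
have a33 : (a ^+ 3 <= 125^-1)%R by rewrite exprS; nra.
lra.
Qed.

Lemma invr_sqrt_ge (a : R) : (0 <= a < 2^-1)%R ->
  (1 + a <= (Num.sqrt (1 - 2 * a))^-1)%R.
Proof.
move=> /andP[a0 a1].
have s0 : (0 < Num.sqrt (1 - 2 * a))%R by rewrite sqrtr_gt0; lra.
rewrite -[leRHS]mul1r ler_pdivlMr//.
rewrite -(@ler_pXn2r _ 2)//; last 2 first.
- by rewrite nnegrE mulr_ge0// ?sqrtr_ge0//; lra.
- by rewrite nnegrE ler01.
rewrite expr1n exprMn sqr_sqrtr; last by lra.
by nra.
Qed.

Let myX s : measurable_fun [set: T] (fun w => y (X s w)).
Proof. exact: measurableT_comp. Qed.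

Let mexp s (a : R) : measurable_fun [set: T] (fun w => (expR (a * y (X s w) ^+ 2))%:E).
Proof.
apply/measurable_EFinP; apply: measurableT_comp => //; apply: measurable_funM => //.
exact: measurable_funX.
Qed.

(** The lower tail needs the transform at [- a], which [chi_square_one] does not give directly. *)
Lemma expectation_expRN_sqr s (a : R) : (0 <= a <= 10^-1)%R ->
  \int[P]_w (expR (- a * y (X s w) ^+ 2))%:E <= (1 - a + 10 * a ^+ 2)%:E.
Proof.
move=> /andP[a0 a1].
have A : \int[P]_w (expR (a * y (X s w) ^+ 2))%:E = ((Num.sqrt (1 - 2 * a))^-1)%:E.
  by apply: y1; lra.
have B : \int[P]_w (expR (2 * a * y (X s w) ^+ 2))%:E = ((Num.sqrt (1 - 2 * (2 * a)))^-1)%:E.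
  by apply: y1; lra.
(* With z = exp (a y^2) >= 1, the bound z^-1 <= 3 - 3 z + z^2 reduces the
   Laplace transform at -a to those at a and 2 a. *)
have : \int[P]_w ((expR (- a * y (X s w) ^+ 2))%:E + 3%:E * (expR (a * y (X s w) ^+ 2))%:E)
   <= \int[P]_w (3%:E + (expR (2 * a * y (X s w) ^+ 2))%:E).
  apply: ge0_le_integral => //.
  - by move=> w _; rewrite adde_ge0// mule_ge0.
  - by apply: emeasurable_funD => //; apply: emeasurable_funM.
  - by apply: emeasurable_funD.
  - move=> w _; rewrite -EFinM -!EFinD lee_fin.
    set x := (a * y (X s w) ^+ 2)%R.
    have x0 : (0 <= x)%R by rewrite mulr_ge0// sqr_ge0.
    have -> : (- a * y (X s w) ^+ 2 = - x)%R by rewrite mulNr.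
    have -> : (2 * a * y (X s w) ^+ 2 = x + x)%R by rewrite /x; lra.
    rewrite expRN expRD; set z := expR x.
    have z1 : (1 <= z)%R by rewrite -expR0 ler_expR.
    have zV : (z * z^-1 = 1)%R by rewrite mulfV// gt_eqF// (lt_le_trans ltr01).
    have : (0 <= (z - 1) ^+ 3)%R by rewrite exprn_ge0// subr_ge0.
    have zV0 : (0 <= z^-1)%R by rewrite invr_ge0; lra.
    move=> /(mulr_ge0 zV0).
    have -> : (z^-1 * (z - 1) ^+ 3 =
      (z * z^-1) * z ^+ 2 - 3 * (z * z^-1) * z + 3 * (z * z^-1) - z^-1)%R by ring.
    rewrite zV expr2; lra.
rewrite ge0_integralD//; last first.
  by apply: emeasurable_funM.
rewrite ge0_integralZl//.
rewrite ge0_integralD// P_cst A B.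
have /invr_sqrt_ge A' : (0 <= a < 2^-1)%R by lra.
have /invr_sqrt_le B' : (0 <= 2 * a <= 5^-1)%R by lra.
have a2 : (0 <= a ^+ 2)%R by rewrite sqr_ge0.
rewrite exprMn in B'.
have : 0 <= \int[P]_w (expR (- a * y (X s w) ^+ 2))%:E by exact: integral_ge0.
case: (\int[P]_w _) => [r| |]//= _.
rewrite -EFinM -!EFinD !lee_fin; lra.
Qed.

Lemma measurable_deviation (J : pred I) (c : R) :
  measurable [set w | (c <= `|\sum_(s | J s) y (X s w) ^+ 2 - #|J|%:R|)%R].
Proof.
pose S w := (\sum_(s | J s) y (X s w) ^+ 2)%R; set A := [set w | _].
rewrite (_ : A = (fun w => `|S w - #|J|%:R|%R) @^-1` `[c, +oo[).
  rewrite -[X in measurable X]setTI.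
  have mS : measurable_fun [set: T] (fun w => `|S w - #|J|%:R|%R).
    apply: measurableT_comp => //; apply: measurable_funB => //.
    by apply: (@measurable_sumX J (fun u => y u ^+ 2)%R); exact: measurable_funX.
  exact: mS.
by apply/seteqP; split => w /=; rewrite /A/= in_itv/= andbT.
Qed.

Lemma chi_square_tail (J : pred I) (eta : R) : (0 <= eta <= 1)%R ->
  P [set w | (eta * #|J|%:R <= `|\sum_(s | J s) y (X s w) ^+ 2 - #|J|%:R|)%R] <=
  (2 * expR (- (#|J|%:R * eta ^+ 2 / 40)))%:E.
Proof.
move=> /andP[e0 e1]; pose S w := (\sum_(s | J s) y (X s w) ^+ 2)%R.
(* The exponent is tuned to the lower tail: the gain [l * eta = eta ^+ 2 / 20] loses
   [10 * l ^+ 2 = eta ^+ 2 / 40] to the second-order term, which leaves exactly [b]. The upper tail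
   loses less. *)
pose l : R := (eta / 20)%R.
pose q1 u : R := (l * (y u ^+ 2 - 1 - eta))%R.
pose q2 u : R := (l * (1 - eta - y u ^+ 2))%R.
pose b : R := (- (eta ^+ 2 / 40))%R.
have l0 : (0 <= l <= 20^-1)%R by rewrite /l; lra.
have my2 : measurable_fun [set: U] (fun u => y u ^+ 2)%R by exact: measurable_funX.
have mq1 : measurable_fun [set: U] q1.
  by apply: measurable_funM => //; apply: measurable_funB => //; apply: measurable_funB.
have mq2 : measurable_fun [set: U] q2.
  by apply: measurable_funM => //; apply: measurable_funB.
have H1 s : \int[P]_w (expR (q1 (X s w)))%:E <= (expR b)%:E.
  rewrite /q1; under eq_integral do rewrite -addrA mulrDr expRD mulrC EFinM.
  rewrite ge0_integralZl// y1; last by lra.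
  have /invr_sqrt_le H : (0 <= l <= 5^-1)%R by lra.
  rewrite -EFinM lee_fin.
  apply: (@le_trans _ _ (expR (l * (-1 - eta)) * expR (l + 5 / 2 * l ^+ 2))%R).
    rewrite ler_wpM2l ?expR_ge0//; apply: (le_trans H).
    by rewrite -addrA expR_ge1Dx.
  by rewrite -expRD ler_expR /b /l; nra.
have H2 s : \int[P]_w (expR (q2 (X s w)))%:E <= (expR b)%:E.
  rewrite /q2; under eq_integral do rewrite mulrDr expRD EFinM mulrN -mulNr.
  rewrite ge0_integralZl//.
  have H : (0 <= l <= 10^-1)%R by lra.
  apply: le_trans.
    by apply: lee_wpmul2l; last exact: (expectation_expRN_sqr s H).
  rewrite -EFinM lee_fin.
  apply: (@le_trans _ _ (expR (l * (1 - eta)) * expR (- l + 10 * l ^+ 2))%R).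
    rewrite ler_wpM2l ?expR_ge0//.
    by rewrite -addrA expR_ge1Dx.
  by rewrite -expRD ler_expR /b /l; nra.
have := leeD (chernoff_sum J mq1 H1) (chernoff_sum J mq2 H2).
rewrite -EFinD /b mulrN mulrA => tails.
rewrite [(2 * _)%R]mulr_natl mulr2n; refine (le_trans _ tails).
have S1 w : (\sum_(s | J s) q1 (X s w) = l * (S w - (1 + eta) * #|J|%:R))%R.
  rewrite -mulr_sumr big_split/= big_split/= !sumr_const -/(S w).
  by rewrite -(mulr_natr (-1)) -(mulr_natr (- eta)); congr (_ * _)%R; ring.
have S2 w : (\sum_(s | J s) q2 (X s w) = l * ((1 - eta) * #|J|%:R - S w))%R.
  rewrite -mulr_sumr big_split/= sumr_const sumrN -/(S w).
  by rewrite -[((1 - eta) *+ _)%R]mulr_natr.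
have mA1 := measurable_sum_ge0 J mq1; have mA2 := measurable_sum_ge0 J mq2.
refine (le_trans _ (measureU2 P mA1 mA2)).
apply: le_measure; rewrite ?inE.
- exact: measurable_deviation.
- exact: measurableU.
move=> w /=; rewrite -/(S w) S1 S2 => H.
have [K|K] := leP (#|J|%:R) (S w); [left|right]; apply: mulr_ge0; try lra.
- by move: H; rewrite ger0_norm ?subr_ge0//; lra.
- by move: H; rewrite ltr0_norm ?subr_lt0//; lra.
Qed.

End chernoff_indep.

(** * Least squares and quadratic forms *)

Section least_squares.
Context {R : realType}.

Lemma dotmx_eq0 (m : nat) (u : 'cV[R]_m) : (u^T *m u) 0 0 = 0 -> u = 0.
Proof.
rewrite mxE => /eqP; rewrite psumr_eq0 => [/allP H|i _]; last by rewrite mxE -expr2 sqr_ge0.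
apply/colP => i; rewrite mxE; apply/eqP.
by have := H i; rewrite mem_index_enum mxE -expr2 sqrf_eq0 => /(_ isT).
Qed.

Lemma dotmx_ge0 (m : nat) (u : 'cV[R]_m) : 0 <= (u^T *m u) 0 0.
Proof. by rewrite mxE sumr_ge0// => i _; rewrite mxE -expr2 sqr_ge0. Qed.

(** Induction on the columns. With [r] the residual of the new column [x] after regression on [A],
    the residual of [b] is corrected along [r]; if [r = 0] the column is redundant and gets weight
    0. *)
Lemma normal_equations (m p : nat) (F : 'M[R]_(m, p)) (b : 'cV[R]_m) :
  exists y : 'cV[R]_p, F^T *m (b - F *m y) = 0.
Proof.
elim: p F b => [|p IH]; last rewrite -[p.+1]/(1 + p)%N; move=> F b.
  by exists 0; rewrite [LHS]flatmx0.
have [x [A ->]] : exists x A, F = row_mx x A :> 'M[R]_(m, 1 + p).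
  by exists (lsubmx F), (rsubmx F); rewrite hsubmxK.
have [y1 y1P] := IH A x; have [y0 y0P] := IH A b.
set r := x - A *m y1 in y1P; set r0 := b - A *m y0 in y0P.
have xE : x = r + A *m y1 by rewrite subrK.
have [s0|sN0] := eqVneq ((r^T *m r) 0 0) 0.
  exists (col_mx 0 y0); rewrite mul_row_col mulmx0 add0r -/r0 tr_row_mx mul_col_mx y0P.
  rewrite xE (dotmx_eq0 s0) add0r trmx_mul -mulmxA y0P mulmx0.
  by rewrite col_mx0.
pose t := (r^T *m r0) 0 0 / (r^T *m r) 0 0.
exists (col_mx t%:M (y0 - t *: y1)).
have -> : b - row_mx x A *m col_mx t%:M (y0 - t *: y1) = r0 - t *: r.
  rewrite mul_row_col mul_mx_scalar mulmxBr -scalemxAr /r0 /r.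
  by apply/colP => i; rewrite !mxE; ring.
have ArP : A^T *m (r0 - t *: r) = 0 by rewrite mulmxBr -scalemxAr y1P y0P scaler0 subr0.
have xT : x^T = r^T + y1^T *m A^T by rewrite -trmx_mul -raddfD -xE.
rewrite tr_row_mx mul_col_mx ArP xT mulmxDl -mulmxA ArP mulmx0 addr0.
rewrite [r^T *m _](_ : _ = 0) ?col_mx0//.
apply/matrixP => i j; rewrite !ord1 mulmxBr -scalemxAr [LHS]mxE [X in _ + X]mxE [X in _ - X]mxE.
by rewrite [RHS]mxE /t divfK// subrr.
Qed.

(** The orthonormal family is kept in the form [F *m B], so that it can be pulled back through [F].
    Columns that depend on those already treated are dropped, hence [q <= p]. *)
Lemma gram_schmidt (m p : nat) (F : 'M[R]_(m, p)) :
  exists q (B : 'M[R]_(p, q)), [/\ (q <= p)%N, (F *m B)^T *m (F *m B) = 1%:M &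
    forall y : 'cV_p, exists z : 'cV_q, F *m y = F *m B *m z].
Proof.
elim: p F => [|p IH]; last rewrite -[p.+1]/(1 + p)%N; move=> F.
  exists 0, 0; split => //; first by rewrite [LHS]flatmx0 [RHS]flatmx0.
  by move=> y; exists 0; rewrite (flatmx0 y) mulmx0 mulmx0.
have [x [A ->]] : exists x A, F = row_mx x A :> 'M[R]_(m, 1 + p).
  by exists (lsubmx F), (rsubmx F); rewrite hsubmxK.
have [q [B [qp B1 BS]]] := IH A.
have [y1 y1P] := normal_equations A x.
set r := x - A *m y1 in y1P.
have xE : x = r + A *m y1 by rewrite subrK.
have FE (y : 'cV[R]_(1 + p)) : exists c z, row_mx x A *m y = r *m c%:M + A *m B *m z.
  have [z zP] := BS (y1 *m usubmx y + dsubmx y).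
  exists (usubmx y 0 0), z; rewrite -zP -[y in LHS]vsubmxK mul_row_col xE mulmxDl.
  by rewrite -mx11_scalar mulmxDr mulmxA addrA.
have [s0|sN0] := eqVneq ((r^T *m r) 0 0) 0.
  exists q, (col_mx 0 B : 'M[R]_(1 + p, q)); split; first by rewrite add1n leqW.
    by rewrite mul_row_col mulmx0 add0r.
  move=> y; have [c [z ->]] := FE y; exists z.
  by rewrite (dotmx_eq0 s0) mul0mx mul_row_col mulmx0 !add0r.
have s0 : 0 < (r^T *m r) 0 0 by rewrite lt0r sN0 dotmx_ge0.
set s := Num.sqrt ((r^T *m r) 0 0).
have sP : 0 < s by rewrite sqrtr_gt0.
have s2 : s ^+ 2 = (r^T *m r) 0 0 by rewrite sqr_sqrtr// ltW.
exists (1 + q)%N, (row_mx (col_mx (s^-1)%:M (- s^-1 *: y1)) (col_mx 0 B) : 'M[R]_(1 + p, 1 + q)).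
have FB : row_mx x A *m row_mx (col_mx (s^-1)%:M (- s^-1 *: y1)) (col_mx 0 B)
    = row_mx (s^-1 *: r) (A *m B).
  rewrite mul_mx_row !mul_row_col mulmx0 add0r mul_mx_scalar -scalemxAr; congr row_mx.
  by rewrite scaleNr -scalerN -scalerDr.
rewrite FB; split; first by rewrite leq_add2l.
  have rAB : r^T *m (A *m B) = 0.
    by rewrite mulmxA -[r^T *m A]trmxK trmx_mul trmxK y1P trmx0 mul0mx.
  have ABr : (A *m B)^T *m r = 0 by rewrite trmx_mul -mulmxA y1P mulmx0.
  rewrite tr_row_mx linearZ/= mul_col_row B1 -!scalemxAl -!scalemxAr rAB ABr !scaler0 scalerA.
  rewrite [_ *: _](_ : _ = 1%:M) -?scalar_mx_block//.
  rewrite (mx11_scalar (r^T *m r)) -s2 scale_scalar_mx; congr (_%:M).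
  by rewrite -invfM mulVf// mulf_neq0 ?gt_eqF.
move=> y; have [c [z ->]] := FE y.
exists (col_mx (s * c)%:M z); rewrite mul_row_col !mul_mx_scalar scalerA.
by rewrite mulrAC mulfV ?mul1r// gt_eqF.
Qed.

End least_squares.

Section quadratic_forms.
Context {R : realType} (n : nat).
Implicit Types (M N : 'M[R]_n) (u v : 'cV[R]_n).

Definition qform M u := (u^T *m M *m u) 0 0.
Definition bform M u v := (u^T *m M *m v) 0 0.

Lemma bformC M u v : M^T = M -> bform M u v = bform M v u.
Proof.
move=> Ms; rewrite /bform -[in LHS](trmxK (u^T *m M *m v)) mxE.
by rewrite !trmx_mul trmxK Ms mulmxA.
Qed.

Lemma qformD M u v : M^T = M ->
  qform M (u + v) = qform M u + 2 * bform M u v + qform M v.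
Proof.
move=> Ms; rewrite /qform [(u + v)^T]raddfD/= !mulmxDl !mulmxDr.
rewrite [LHS]mxE [X in X + _]mxE [X in _ + X]mxE.
rewrite -/(bform M u v) -/(bform M v u) (bformC v u Ms).
by rewrite mulr_natl mulr2n !addrA.
Qed.

Lemma qformZ M a u : qform M (a *: u) = a ^+ 2 * qform M u.
Proof. by rewrite /qform [(a *: u)^T]linearZ/= -!scalemxAl -scalemxAr scalerA mxE expr2. Qed.

Lemma bformZr M a u v : bform M u (a *: v) = a * bform M u v.
Proof. by rewrite /bform -scalemxAr mxE. Qed.

Lemma bformNr M u v : bform M u (- v) = - bform M u v.
Proof. by rewrite /bform mulmxN mxE. Qed.

Lemma qformN M u : qform M (- u) = qform M u.
Proof. by rewrite -scaleN1r qformZ sqrrN expr1n mul1r. Qed.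

Lemma qform_gram (k : nat) (A : 'M[R]_(k, n)) u :
  qform (A^T *m A) u = \sum_i ((A *m u) i 0) ^+ 2.
Proof.
rewrite /qform mulmxA -trmx_mul -mulmxA mxE.
by apply: eq_bigr => i _; rewrite mxE expr2.
Qed.

(** Polarization: [4 * bform M u v] is the difference of the two values of [qform M], and the
    parallelogram law for [N] sums the two bounds. *)
Lemma bform_le M N b u v : M^T = M -> N^T = N ->
  `|qform M (u + v)| <= b * qform N (u + v) ->
  `|qform M (u - v)| <= b * qform N (u - v) ->
  2 * `|bform M u v| <= b * (qform N u + qform N v).
Proof.
move=> Ms Ns; rewrite !qformD// !bformNr !qformN => /ler_normlP[H1 H2] /ler_normlP[H3 H4].
by case: ler0P => _; lra.
Qed.

(** The free weight [c] balances vectors of different sizes; it comes from rescaling [v] by [c^-1]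
    in the polarized bound. *)
Lemma bform_le_scale M N b c u v : M^T = M -> N^T = N -> 0 < c ->
  (forall a, `|qform M (u + a *: v)| <= b * qform N (u + a *: v)) ->
  2 * `|bform M u v| <= b * (c * qform N u + c^-1 * qform N v).
Proof.
move=> Ms Ns c0 H.
have := @bform_le M N b u (c^-1 *: v) Ms Ns (H _).
rewrite -scaleNr => /(_ (H _)); rewrite bformZr qformZ normrM gtr0_norm ?invr_gt0//.
rewrite -(ler_pM2l c0) => K.
have -> : 2 * `|bform M u v| = c * (2 * (c^-1 * `|bform M u v|)).
  by rewrite mulrCA mulVKf ?gt_eqF.
apply: (le_trans K); rewrite le_eqVlt; apply/orP; left; apply/eqP.
by field; rewrite gt_eqF.
Qed.

End quadratic_forms.

(** * Lattice nets and restricted isometry *)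

Section lattice_net.
Context {R : realType}.

Lemma qform1 (n : nat) (u : 'cV[R]_n) : qform 1%:M u = \sum_i u i 0 ^+ 2.
Proof. by rewrite /qform mulmx1 mxE; apply: eq_bigr => i _; rewrite mxE expr2. Qed.

Lemma qform1_ge0 (n : nat) (u : 'cV[R]_n) : 0 <= qform 1%:M u.
Proof. by rewrite qform1 sumr_ge0// => i _; rewrite sqr_ge0. Qed.

(* Integer points with coordinates in [-4p, 4p], as sign bits and absolute values. *)
Definition lattice (p : nat) := {ffun 'I_p -> bool * 'I_(4 * p).+1}.

Definition latvec (p : nat) (z : lattice p) : 'cV[R]_p :=
  \col_i ((-1) ^+ (z i).1 * (z i).2%:R).

Lemma qform1_latvec (p : nat) (z : lattice p) :
  qform 1%:M (latvec z) = (\sum_i (z i).2 ^ 2)%:R.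
Proof.
rewrite qform1 natr_sum; apply: eq_bigr => i _.
by rewrite mxE exprMn sqrr_sign mul1r natrX.
Qed.

(** Coordinates are truncated toward zero: the norm does not grow and each coordinate moves by less
    than 1. At squared norm [16 * p] every coordinate is at most [4 * p] in absolute value, so the
    result stays in the box. *)
Lemma latvec_round (p : nat) (y : 'cV[R]_p) : qform 1%:M y = (16 * p)%:R ->
  exists2 z : lattice p, qform 1%:M (latvec z) <= (16 * p)%:R &
    qform 1%:M (y - latvec z) <= p%:R.
Proof.
move=> yp.
pose a i := Num.truncn `|y i 0|.
have aP i : (a i)%:R <= `|y i 0| < (a i).+1%:R by exact: truncn_itv.
have ap i : (a i < (4 * p).+1)%N.
  rewrite ltnS -(@ler_nat R).
  have p1 : (1 <= p)%N by case: (i) => m; case: p {y yp a aP i}.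
  have /andP[ai _] := aP i; apply: (le_trans ai).
  rewrite -(@ler_pXn2r _ 2)// ?nnegrE// real_normK ?num_real//.
  apply: (@le_trans _ _ (16 * p)%:R).
    rewrite -yp qform1 (bigD1 i)//= lerDl sumr_ge0// => j _; exact: sqr_ge0.
  by rewrite -natrX ler_nat expnMn leq_mul2l/= -{1}(muln1 p) leq_mul2l p1 orbT.
pose z : lattice p := [ffun i => (y i 0 < 0, Ordinal (ap i))].
have yE i := numEsign (y i 0).
exists z.
  rewrite -yp !qform1; apply: ler_sum => i _; rewrite mxE ffunE/=.
  have /andP[ai _] := aP i.
  by rewrite exprMn sqrr_sign mul1r -(real_normK (num_real (y i 0))) lerXn2r ?nnegrE.
rewrite qform1 (_ : p%:R = \sum_(i < p) 1); last by rewrite sumr_const card_ord.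
apply: ler_sum => i _; rewrite !mxE ffunE/= {1}yE -mulrBr exprMn sqrr_sign mul1r.
have /andP[ai] := aP i; rewrite -natr1 => ai1.
by rewrite expr_le1 ?subr_ge0//; lra.
Qed.

Lemma card_lattice_ball (p : nat) :
  (#|[pred z : lattice p | (\sum_i (z i).2 ^ 2 <= 16 * p)%N]|)%:R <= 2 ^+ (18 * p) :> R.
Proof.
rewrite -sum1_card natr_sum.
(* On the ball, 2 ^ (16 p - sum of (z i)^2) >= 1. *)
apply: (@le_trans _ _ (\sum_(z : lattice p) \prod_i (2 ^+ 16 * 2 ^- (z i).2))).
  rewrite big_mkcond/=; apply: ler_sum => z _; case: ifP => [zp|_]; last first.
    by apply: prodr_ge0 => i _; rewrite mulr_ge0// ?invr_ge0 exprn_ge0.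
  rewrite big_split/= prodr_const card_ord -exprM prodfV prodrXr.
  rewrite ler_pdivlMr ?exprn_gt0// mul1r ler_eXn2l ?ltr1n//.
  (* A natural number is at most its square; weights in [z] rather than in its square make the sums
     below geometric. *)
  apply: leq_trans zp; apply: leq_sum => i _.
  by case: (nat_of_ord _) => // m; rewrite expnS expn1 leq_pmulr.
rewrite -(bigA_distr_bigA (fun (_ : 'I_p) (j : bool * 'I_(4 * p).+1) => 2 ^+ 16 * 2 ^- j.2 : R))/= prodr_const card_ord.
rewrite exprM lerXn2r// ?nnegrE.
- by apply: sumr_ge0 => j _; rewrite mulr_ge0// ?invr_ge0 exprn_ge0.
- by rewrite exprn_ge0.
rewrite -mulr_sumr -[18%N]/(16 + 2)%N exprD ler_pM2l ?exprn_gt0//.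
rewrite -(pair_big xpredT xpredT (fun _ (j : 'I_(4 * p).+1) => 2 ^- j : R))/=.
rewrite big_bool/=.
(* Two signs and a geometric sum of at most 2 cost [2 ^ 2] per coordinate, whence [18 = 16 + 2]. *)
suff : \sum_(j < (4 * p).+1) 2 ^- j <= 2 :> R by lra.
elim: (4 * p)%N => [|m IH]; first by rewrite big_ord1 expr0 invr1 ler1n.
rewrite big_ord_recl expr0 invr1.
under eq_bigr => i _ do rewrite lift0 exprS invfM.
by rewrite -mulr_sumr; lra.
Qed.

Lemma net_bound (p : nat) (H : 'M[R]_p) (eta : R) : H^T = H -> 0 <= eta ->
  (forall z : lattice p, qform 1%:M (latvec z) <= (16 * p)%:R ->
    `|qform H (latvec z)| <= eta * (16 * p)%:R) ->
  forall u, `|qform H u| <= 3 * eta * qform 1%:M u.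
Proof.
move=> Hs eta0 Hnet.
pose Q b := forall u, `|qform H u| <= b * qform 1%:M u.
(* Some finite constant is needed to start the iteration; this one comes from bounding each product
   of two coordinates of [u] by its squared norm. *)
pose b0 := \sum_i \sum_j `|H i j|.
have Q0 : Q b0.
  move=> u; rewrite {1}/qform /b0 mxE exchange_big/= mulr_suml.
  apply: (le_trans (ler_norm_sum _ _ _)).
  apply: ler_sum => j _; rewrite mxE mulr_suml mulr_suml.
  apply: (le_trans (ler_norm_sum _ _ _)).
  apply: ler_sum => i _; rewrite mxE mulrAC mulrC !normrM ler_wpM2l//.
  have uk k : u k 0 ^+ 2 <= qform 1%:M u.
    by rewrite qform1 (bigD1 k)//= lerDl sumr_ge0// => l _; exact: sqr_ge0.
  have := uk i; have := uk j; rewrite -(real_normK (num_real (u i 0))) -(real_normK (num_real (u j 0))).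
  by have := sqr_ge0 (`|u i 0| - `|u j 0|); rewrite sqrrB; lra.
(* Rounding to the net improves the constant b to eta + 5/8 b, whose fixed point
   8/3 eta is below 3 eta. *)
have Qstep b : 0 <= b -> Q b -> Q (eta + 5 / 8 * b).
  move=> b_ge0 Qb.
  have sphere y : qform 1%:M y = (16 * p)%:R -> `|qform H y| <= (eta + 5 / 8 * b) * (16 * p)%:R.
    move=> yp; have [z zp rp] := latvec_round yp.
    have hz := Hnet _ zp.
    set v := latvec z in zp rp hz; set r := y - v in rp.
    have s1 : (1%:M : 'M[R]_p)^T = 1%:M by rewrite trmx1.
    have yvp : qform 1%:M (y + v) <= 64 * p%:R.
      have : 0 <= qform 1%:M r by exact: qform1_ge0.
      rewrite /r !qformD// bformNr qformN; move: zp; rewrite yp natrM; lra.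
    (* For symmetric [H], the difference of the forms at [y] and [v] factors as the form at the pair
       [y - v], [y + v]. *)
    have E : qform H y = qform H v + bform H r (y + v).
      have -> : bform H r (y + v) = qform H y - qform H v.
        rewrite /bform /r [(y - v)^T]raddfB/= !mulmxBl !mulmxDr.
        rewrite [LHS]mxE [X in X + _]mxE [X in _ + X]mxE [X in _ - X]mxE.
        rewrite -/(bform H v y) (bformC v y Hs) -/(qform H y) -/(qform H v).
        by rewrite /bform; lra.
      by rewrite addrC subrK.
    (* The squared norms of [r] and [y + v] are at most [p] and [64 * p]. The weight 16 balances
       them: [16 * p + 64 * p / 16 = 20 * p], half of which is [5 / 8] of [16 * p]. *)
    have K := @bform_le_scale R p H 1%:M b 16 r (y + v) Hs s1 ltac:(by rewrite ltr0n) (fun a => Qb _).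
    rewrite E; apply: (le_trans (ler_normD _ _)); rewrite natrM in hz *.
    have : b * (16 * qform 1%:M r + 16^-1 * qform 1%:M (y + v)) <= b * (20 * p%:R).
      by apply: ler_wpM2l => //; lra.
    lra.
  move=> u; have [u0|u0] := eqVneq (qform 1%:M u) 0.
    by have := Qb u; rewrite u0 !mulr0.
  have up : 0 < qform 1%:M u by rewrite lt0r u0 qform1_ge0.
  pose t := Num.sqrt ((16 * p)%:R / qform 1%:M u).
  have p0 : (0 < p)%N.
    by case: p H Hs Hnet Q b0 Q0 Qb sphere u u0 up t => // H _ _ Q _ _ _ _ u; rewrite qform1 big_ord0 eqxx.
  have t2 : t ^+ 2 = (16 * p)%:R / qform 1%:M u by rewrite sqr_sqrtr// divr_ge0// ltW.
  have t0 : 0 < t ^+ 2 by rewrite t2 divr_gt0// ltr0n muln_gt0.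
  have := sphere (t *: u); rewrite !qformZ t2 divfK// => /(_ erefl).
  rewrite -t2 normrM (ger0_norm (ltW t0)) => K.
  rewrite -(ler_pM2l t0); apply: (le_trans K).
  by rewrite mulrCA t2 divfK.
have b00 : 0 <= b0 by apply: sumr_ge0 => i _; apply: sumr_ge0 => j _.
have Qm m : Q (3 * eta + (5 / 8) ^+ m * b0).
  elim: m => [|m IH].
    by move=> u; rewrite expr0 mul1r mulrDl; apply: (le_trans (Q0 u)); rewrite lerDr !mulr_ge0// qform1_ge0.
  have c0 : 0 <= (5 / 8) ^+ m * b0 by rewrite mulr_ge0// exprn_ge0// divr_ge0.
  have := Qstep _ _ IH; rewrite addr_ge0 ?mulr_ge0// => /(_ isT) K u.
  apply: (le_trans (K u)); apply: ler_wpM2r; first exact: qform1_ge0.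
  by rewrite exprS; lra.
move=> u; apply/ler_addgt0Pr => e e0.
have : (5 / 8) ^+ m * (b0 * qform 1%:M u) @[m --> \oo] --> (0 : R).
  rewrite -[X in _ --> X](mul0r (b0 * qform 1%:M u)).
  apply: cvgMr_tmp; apply: cvg_expr; rewrite ger0_norm; lra.
move=> /cvgrPdist_lt/(_ _ e0)[m _ /(_ m (leqnn m))/=].
rewrite sub0r normrN ger0_norm; last by rewrite !mulr_ge0 ?exprn_ge0 ?qform1_ge0.
by move=> me; apply: (le_trans (Qm m u)); rewrite mulrDl -[X in _ + X]mulrA lerD2l ltW.
Qed.

End lattice_net.

(** * Restricted isometry on sparse vectors *)

Section restricted_isometry.
Context {R : realType} (d : measure_display) (T : measurableType d)
  (P : probability T R) (n N : nat) (X : 'I_N -> {RV P >-> n.-tuple R})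
  (Sigma : 'M[R]_n).
Hypotheses (indX : mutually_independent X)
  (gaussX : forall s, gaussian_vector (X s) Sigma).

Definition sample (w : T) (s : 'I_N) : 'cV[R]_n := \col_j tnth (X s w) j.

(** The unnormalized empirical second moment over the samples in [J]; both halves of the data thus
    refer to one independent family. *)
Definition scatter (J : pred 'I_N) (w : T) : 'M[R]_n :=
  \sum_(s | J s) sample w s *m (sample w s)^T.

Definition linform (v : 'cV[R]_n) (x : n.-tuple R) : R := \sum_j tnth x j * v j 0.

Lemma tr_scatter J w : (scatter J w)^T = scatter J w.
Proof. by rewrite /scatter raddf_sum/=; apply: eq_bigr => s _; rewrite trmx_mul trmxK. Qed.

Lemma qform_scatter J w v :
  qform (scatter J w) v = \sum_(s | J s) linform v (X s w) ^+ 2.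
Proof.
rewrite /qform /scatter mulmx_sumr mulmx_suml summxE; apply: eq_bigr => s _.
rewrite mulmxA -mulmxA mxE big_ord1 expr2; congr (_ * _); rewrite mxE.
  by apply: eq_bigr => j _; rewrite !mxE mulrC.
by apply: eq_bigr => j _; rewrite !mxE.
Qed.

Lemma measurable_linform v : measurable_fun setT (linform v).
Proof.
apply: measurable_sum => j; apply: measurable_funM => //; exact: measurable_tnth.
Qed.

(** With [Sigma = A *m A^T], this is the linear form in [Z] with coefficients [A^T *m v], whose
    squared Euclidean norm is [qform Sigma v = 1]. *)
Lemma chi_square_linform v : qform Sigma v = 1 -> chi_square_one X (linform v).
Proof.
move=> v1 s a a12; have [A [Z [AS nZ iZ XE]]] := gaussX s.
pose c l := (A^T *m v) l 0.
rewrite -(@expectation_expR_sqr_linear _ _ _ P n Z c a)//.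
  apply: eq_integral => w _; congr (expR (_ * _ ^+ 2))%:E.
  rewrite /linform; under eq_bigr do rewrite XE mulr_suml.
  rewrite exchange_big/=; apply: eq_bigr => l _; rewrite /c mxE mulr_suml.
  by apply: eq_bigr => j _; rewrite mxE mulrAC.
by rewrite -v1 -AS -{1}[A]trmxK qform_gram.
Qed.

Lemma probability_finite_union (I : Type) (s : seq I) (A : I -> set T) (b : R) :
  (forall i, measurable (A i)) -> (forall i, (P (A i) <= b%:E)%E) ->
  measurable (\big[setU/set0]_(i <- s) A i) /\
  (P (\big[setU/set0]_(i <- s) A i) <= ((size s)%:R * b)%:E)%E.
Proof.
move=> mA Ab; elim: s => [|i s [IHm IHb]]; first by rewrite big_nil measure0 mul0r; split.
rewrite big_cons; split; first exact: measurableU.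
apply: (le_trans (measureU2 P (mA i) IHm)).
by rewrite /= -natr1 mulrDl mul1r addrC EFinD leeD.
Qed.

Variable (J : pred 'I_N) (eta : R).
Hypothesis eta01 : 0 <= eta <= 1.
Let k : R := #|J|%:R.
Let tail : R := 2 * expR (- (k * eta ^+ 2 / 40)).

(** In coordinates orthonormal for [Sigma] on the range of [M], the claim bounds a symmetric matrix
    [H]. [net_bound] reduces it to lattice directions, each controlled by the chi-square tail; at
    most [2 ^ (18 * p)] of them enter the union bound. *)
Lemma rip_subspace (A : 'M[R]_n) (p : nat) (M : 'M[R]_(n, p)) :
  A *m A^T = Sigma -> A \in unitmx ->
  exists E : set T, [/\ measurable E, (P E <= (2 ^+ (18 * p) * tail)%:E)%E &
    forall w, ~ E w -> forall y : 'cV_p,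
      `|qform (scatter J w) (M *m y) - k * qform Sigma (M *m y)|
        <= 3 * eta * k * qform Sigma (M *m y)].
Proof.
move=> AS Au; have [q [B [qp B1 BS]]] := gram_schmidt (A^T *m M).
pose v (u : 'cV[R]_q) : 'cV[R]_n := M *m B *m u.
have qv u : qform Sigma (v u) = qform 1%:M u.
  rewrite -AS -{1}[A]trmxK -B1 !qform_gram.
  by apply: eq_bigr => i _; rewrite /v !mulmxA.
pose nz (z : lattice q) := qform 1%:M (latvec z : 'cV[R]_q).
pose vz (z : lattice q) := (Num.sqrt (nz z))^-1 *: v (latvec z).
(* A null lattice vector has no direction to normalize; its bad event is empty, as the bound is
   trivial there. *)
pose bad z := if nz z == 0 then set0 else
  [set w | eta * #|J|%:R <= `|\sum_(s | J s) linform (vz z) (X s w) ^+ 2 - #|J|%:R|].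
have tail0 : 0 <= tail by rewrite mulr_ge0// expR_ge0.
have mbad z : measurable (bad z).
  rewrite /bad; case: ifP => _ //.
  exact: (measurable_deviation X (measurable_linform (vz z))).
have Pbad z : (P (bad z) <= tail%:E)%E.
  rewrite /bad; case: eqVneq => [_|z0]; first by rewrite measure0 lee_fin.
  apply: chi_square_tail => //; first exact: measurable_linform.
  apply: chi_square_linform; rewrite qformZ qv exprVn sqr_sqrtr ?qform1_ge0//.
  by rewrite mulVf.
pose ball := enum [pred z : lattice q | (\sum_i (z i).2 ^ 2 <= 16 * q)%N].
have [mE PE] := @probability_finite_union _ ball bad tail mbad Pbad.
exists (\big[setU/set0]_(z <- ball) bad z); split => //.
  apply: (le_trans PE); rewrite lee_fin ler_wpM2r// -cardE.
  apply: (le_trans (card_lattice_ball q)).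
  by rewrite ler_eXn2l ?ltr1n// leq_mul2l.
move=> w wE y; have [u yu] := BS y.
have -> : M *m y = v u.
  apply: (can_inj (mulKmx (_ : A^T \in unitmx))); first by rewrite unitmx_tr.
  by rewrite /v !mulmxA yu.
pose K := M *m B; pose H := K^T *m scatter J w *m K - k *: 1%:M.
have HE x : qform H x = qform (scatter J w) (v x) - k * qform 1%:M x.
  rewrite {1}/qform /H mulmxBr mulmxBl mxE [X in _ + X]mxE -scalemxAr -scalemxAl.
  rewrite [X in _ - X]mxE; congr (_ - _).
  by rewrite /qform /v -/K (trmx_mul K x) !mulmxA.
rewrite qv -HE.
have k0 : 0 <= k by rewrite /k ler0n.
have /andP[e0 e1] := eta01.
rewrite -[3 * eta * k]mulrA.
apply: net_bound.
- by rewrite /H raddfB/= linearZ/= trmx1 (trmx_mul _ K) (trmx_mul K^T) trmxK tr_scatter mulmxA.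
- exact: mulr_ge0.
move=> z; rewrite qform1_latvec ler_nat => z16.
have zE : nz z = (\sum_i (z i).2 ^ 2)%:R by exact: qform1_latvec.
have zle : nz z <= (16 * q)%:R by rewrite zE ler_nat.
rewrite HE -/(nz z).
have [z0|z0] := eqVneq (nz z) 0.
  have : (latvec z : 'cV[R]_q) = 0.
    by apply: dotmx_eq0; move: z0; rewrite /nz /qform mulmx1.
  rewrite z0 /v => ->; rewrite mulmx0 mulr0 subr0 /qform mulmx0 mxE normr0.
  by rewrite !mulr_ge0.
have zp : 0 < nz z by rewrite lt0r z0 qform1_ge0.
have : ~ bad z w.
  move=> bz; apply: wE; rewrite -bigcup_seq; exists z => //=.
  by rewrite mem_enum inE.
rewrite /bad (negbTE z0) /= => /negP; rewrite -ltNge -qform_scatter qformZ exprVn sqr_sqrtr ?qform1_ge0//.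
rewrite -/k -(ltr_pM2l zp) -[X in X * `|_|](gtr0_norm zp) -normrM mulrBr mulVKf// => /ltW dev.
rewrite [k * _]mulrC; apply: (le_trans dev).
by rewrite mulrC ler_wpM2l// mulr_ge0.
Qed.

Lemma rip_sparse (A : 'M[R]_n) (p : nat) : (0 < n)%N ->
  A *m A^T = Sigma -> A \in unitmx ->
  exists E : set T, [/\ measurable E,
    (P E <= (n%:R ^+ p * (2 ^+ (18 * p) * tail))%:E)%E &
    forall w, ~ E w -> forall v : 'cV_n, (#|supp v| <= p)%N ->
      `|qform (scatter J w) v - k * qform Sigma v| <= 3 * eta * k * qform Sigma v].
Proof.
move=> n0 AS Au.
(* Supports of size at most p are images of maps from 'I_p. *)
pose sel (f : {ffun 'I_p -> 'I_n}) : 'M[R]_(n, p) := \matrix_(i, l) (i == f l)%:R.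
have /choice[E EP] := fun f => rip_subspace (sel f) AS Au.
have [mE PE] := @probability_finite_union _ (enum {ffun 'I_p -> 'I_n}) E
  (2 ^+ (18 * p) * tail) (fun f => let: And3 m _ _ := EP f in m)
  (fun f => let: And3 _ b _ := EP f in b).
exists (\big[setU/set0]_(f <- enum {ffun 'I_p -> 'I_n}) E f); split => //.
  by move: PE; rewrite -cardT card_ffun !card_ord natrX.
move=> w wE v vp.
pose i0 := Ordinal n0.
pose s := enum (supp v).
pose f : {ffun 'I_p -> 'I_n} := [ffun l : 'I_p => nth i0 s l].
(* Beyond the end of [s], [f] takes the default [i0], which may already be in the support; the
   coefficient 0 avoids counting it twice. *)
pose y : 'cV[R]_p := \col_l (if (l < size s)%N then v (f l) 0 else 0).
have -> : v = sel f *m y.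
  apply/colP => i; rewrite mxE.
  have [iv|iv] := boolP (i \in supp v).
    have ls : (index i s < size s)%N by rewrite index_mem mem_enum.
    have lp : (index i s < p)%N by apply: (leq_trans ls); rewrite -cardE.
    rewrite (bigD1 (Ordinal lp))//= !mxE ffunE/= ls nth_index ?mem_enum// eqxx mul1r.
    rewrite big1 ?addr0// => l ll0; rewrite !mxE ffunE.
    case: ifP => [lsz|_]; last by rewrite mulr0.
    case: eqVneq => [il|_]; last by rewrite mul0r.
    case/eqP: ll0; apply: val_inj => /=.
    by rewrite il index_uniq// enum_uniq.
  rewrite big1 => [|l _]; first by move: iv; rewrite inE negbK => /eqP.
  rewrite !mxE ffunE; case: ifP => [lsz|_]; last by rewrite mulr0.
  case: eqVneq => [il|_]; last by rewrite mul0r.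
  by case/negP: iv; rewrite il -mem_enum mem_nth.
have [_ _ H] := EP f; apply: H => Ef.
by apply: wE; rewrite -bigcup_seq; exists f => //=; rewrite mem_enum.
Qed.

End restricted_isometry.

(** * The algorithm *)

Section algorithm.
Context {R : realType}.

Lemma rss_qform (k n : nat) (D : 'M[R]_(k, n)) (i : 'I_n) (w : 'cV[R]_n) :
  rss D i w = qform (D^T *m D) (delta_mx i 0 - w).
Proof.
rewrite qform_gram; apply: eq_bigr => r _.
by rewrite mulmxBr -colE !mxE.
Qed.

Lemma rss_ge0 (k n : nat) (D : 'M[R]_(k, n)) (i : 'I_n) (w : 'cV[R]_n) : 0 <= rss D i w.
Proof. by rewrite sumr_ge0// => r _; rewrite sqr_ge0. Qed.

(** Normal equations for [D *m E], where [E] erases the coordinates outside [S]: the residual [r] is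
    orthogonal to any further change [z], and Pythagoras gives minimality. *)
Lemma rss_min_on (k n : nat) (D : 'M[R]_(k, n)) (i : 'I_n) (S : {set 'I_n}) :
  exists w, supp w \subset S /\
    forall v, supp v \subset S -> rss D i w <= rss D i v.
Proof.
pose E : 'M[R]_n := \matrix_(a, b) ((a == b) && (a \in S))%:R.
have Ev (v : 'cV[R]_n) a : (E *m v) a 0 = (a \in S)%:R * v a 0.
  rewrite mxE (bigD1 a)//= mxE eqxx big1 ?addr0// => b ba.
  by rewrite mxE eq_sym (negbTE ba) mul0r.
have EvS v : supp v \subset S -> E *m v = v.
  move=> /fintype.subsetP vS; apply/colP => a; rewrite Ev.
  have [aS|aS] := boolP (a \in S); first by rewrite mul1r.
  have := contra (vS a) aS; rewrite inE negbK => /eqP ->; by rewrite mulr0.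
have [y yP] := normal_equations (D *m E) (D *m delta_mx i 0).
exists (E *m y); split.
  apply/fintype.subsetP => a; rewrite inE Ev; case: (a \in S) => //.
  by rewrite mul0r eqxx.
move=> v /EvS <-.
pose r := D *m delta_mx i 0 - D *m E *m y; rewrite -/r in yP.
have rssE x : rss D i (E *m x) = ((r - D *m E *m (x - y))^T *m (r - D *m E *m (x - y))) 0 0.
  rewrite mxE; apply: eq_bigr => a _; rewrite [_^T _ _]mxE -expr2.
  congr (_ ^+ 2); rewrite /r mulmxBr -colE mulmxA !mxE; ring.
rewrite (rssE v) (rssE y) subrr mulmx0 subr0.
rewrite -/r; pose z := D *m E *m (v - y); rewrite -/z.
have zr : z^T *m r = 0 by rewrite trmx_mul -mulmxA yP mulmx0.
have rz : r^T *m z = 0 by rewrite -[LHS]trmxK trmx_mul trmxK zr trmx0.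
clearbody r z.
rewrite [(r - z)^T]raddfB/= mulmxBl !mulmxBr zr rz !subr0 sub0r opprK.
by rewrite [leRHS]mxE lerDl dotmx_ge0.
Qed.

(** Least squares on each of finitely many supports, then the best support. Existence matters
    because [search_and_validate] is a relation, which would have no output without minimizers. *)
Lemma best_subset_exists (k n : nat) (D : 'M[R]_(k, n)) (i : 'I_n) (s : nat) :
  exists w, best_subset D i s w.
Proof.
have [W WP] := choice (rss_min_on D i).
pose ok (S : {set 'I_n}) := (i \notin S) && (#|S| <= s)%N.
have ok0 : ok finset.set0 by rewrite /ok inE cards0.
case: (arg_minP (fun S => rss D i (W S)) ok0) => S /andP[iS Ss] Smin.
have [WS _] := WP S.
exists (W S); split.
  split; last exact: leq_trans (subset_leq_card WS) Ss.
  by apply/eqP; apply: contraNT iS => Wi; apply: (fintype.subsetP WS); rewrite inE.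
move=> v [vi vs]; apply: ler_wpM2l; first by rewrite invr_ge0.
apply: (@le_trans _ _ (rss D i (W (supp v)))).
  by apply: Smin; rewrite /ok vs inE vi eqxx.
by have [_] := WP (supp v); apply.
Qed.

Lemma validate_first (k n : nat) (D : 'M[R]_(k, n)) (i : 'I_n) (deg : nat) (nu : R)
    (w : 'I_deg.+1 -> 'cV[R]_n) (t : 'I_deg.+1) :
  ~~ rejected D i nu w t -> (forall d1 : 'I_deg.+1, (d1 < t)%N -> rejected D i nu w d1) ->
  validate D i nu w = Some (supp (w t)).
Proof.
move=> tN tR; rewrite /validate.
have -> : enum 'I_deg.+1 = take t (enum 'I_deg.+1) ++ t :: drop t.+1 (enum 'I_deg.+1).
  by rewrite -[LHS](cat_take_drop t) (drop_nth t) ?size_enum_ord// nth_ord_enum.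
rewrite filter_cat (_ : [seq x <- take t _ | _] = [::]) /=; first by rewrite tN.
apply/eqP; rewrite -[_ == _]negbK -has_filter; apply/hasPn => x.
rewrite in_take ?mem_enum// index_enum_ord => xt; by rewrite negbK tR.
Qed.

Lemma ols_var_inf_le (k n : nat) (D : 'M[R]_(k, n)) (i : 'I_n) (S : {set 'I_n})
    (w : 'cV[R]_n) : supp w \subset S ->
  inf [set rss D i v | v in [set v : 'cV[R]_n | supp v \subset S]] <= rss D i w.
Proof.
move=> wS; apply: ge_inf; last by exists w.
by exists 0 => _ [v _ <-]; exact: rss_ge0.
Qed.

Lemma ols_var_inf_ge (k n : nat) (D : 'M[R]_(k, n)) (i : 'I_n) (S : {set 'I_n}) (b : R) :
  (forall w, supp w \subset S -> b <= rss D i w) ->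
  b <= inf [set rss D i v | v in [set v : 'cV[R]_n | supp v \subset S]].
Proof.
move=> bS; apply: lb_le_inf.
  exists (rss D i 0), 0 => //=; apply/fintype.subsetP => j; by rewrite inE mxE eqxx.
by move=> _ [v vS <-]; exact: bS.
Qed.

End algorithm.

(** * Recovery of one neighborhood from the isometry *)

Section recovery.
Context {R : realType} (n : nat) (A : 'M[R]_n) (kappa : R) (deg k : nat) (i : 'I_n).
Hypotheses (Au : A \in unitmx).
Let Sigma : 'M[R]_n := A *m A^T.
Let Theta : 'M[R]_n := invmx Sigma.
Hypotheses (kappa01 : 0 < kappa <= 1)
  (nondeg : kappa_nondegenerate kappa Theta)
  (degN : (#|neighbors Theta i| <= deg)%N).

Let N := neighbors Theta i.

Let Su : Sigma \in unitmx.
Proof. by rewrite unitmx_mul unitmx_tr Au. Qed.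

Let Ss : Sigma^T = Sigma.
Proof. by rewrite trmx_mul trmxK. Qed.

Let Ts : Theta^T = Theta.
Proof. by rewrite /Theta trmx_inv Ss. Qed.

Let q_ge0 v : 0 <= qform Sigma v.
Proof.
by rewrite -[A in qform (A *m _)]trmxK qform_gram sumr_ge0// => j _; rewrite sqr_ge0.
Qed.

Let t j : 'cV[R]_n := col j Theta.

Let bform_t j v : bform Sigma (t j) v = v j 0.
Proof.
rewrite /bform /t colE trmx_mul Ts -(mulmxA _ Theta) mulVmx// mulmx1 trmx_delta.
by rewrite -rowE mxE.
Qed.

Let qform_t j : qform Sigma (t j) = Theta j j.
Proof. by rewrite -[LHS]/(bform Sigma (t j) (t j)) bform_t mxE. Qed.

Let T_gt0 j : 0 < Theta j j.
Proof.
rewrite -qform_t lt0r q_ge0 andbT; apply/negP => /eqP.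
rewrite -[A in qform (A *m _)]trmxK /qform mulmxA -trmx_mul -mulmxA => /dotmx_eq0 tj0.
have t0 : t j = 0 by rewrite -[t j](mulKmx (_ : A^T \in unitmx)) ?unitmx_tr// tj0 mulmx0.
have := bform_t j (delta_mx j 0); rewrite t0 /bform trmx0 !mul0mx !mxE !eqxx => /eqP.
by rewrite eq_sym oner_eq0.
Qed.

(** Cauchy-Schwarz for [Sigma] against [t j]: the form is nonnegative at [v] minus its projection on
    [t j]. *)
Let sq_entry_le (j : 'I_n) (v : 'cV[R]_n) : v j 0 ^+ 2 <= qform Sigma v * Theta j j.
Proof.
have := q_ge0 (v - (v j 0 / Theta j j) *: t j).
rewrite qformD// bformNr qformN bformZr qformZ (bformC _ _ Ss) bform_t qform_t.
rewrite -(pmulr_lge0 _ (T_gt0 j)) => H; rewrite -subr_ge0; apply: le_trans H _.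
rewrite le_eqVlt; apply/orP; left; apply/eqP.
by field; rewrite gt_eqF.
Qed.

(* The residual of the population regression of coordinate i on the others;
   its inner product with v under Sigma is v_i / Theta_ii. *)
Definition residual_dir : 'cV[R]_n := (Theta i i)^-1 *: t i.
Definition regression : 'cV[R]_n := delta_mx i 0 - residual_dir.
Local Notation ustar := residual_dir.
Local Notation wstar := regression.

Let bform_ustar v : bform Sigma ustar v = v i 0 / Theta i i.
Proof. by rewrite (bformC _ _ Ss) bformZr (bformC _ _ Ss) bform_t mulrC. Qed.

Let qform_ustar : qform Sigma ustar = (Theta i i)^-1.
Proof. by rewrite qformZ qform_t expr2 -mulrA mulVf ?mulr1// gt_eqF. Qed.

Let wstar_i : wstar i 0 = 0.
Proof. by rewrite !mxE !eqxx/= mulVf ?subrr// gt_eqF. Qed.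

Let wstarE (j : 'I_n) : j != i -> wstar j 0 = - (Theta i j / Theta i i).
Proof.
move=> ji; rewrite !mxE (negbTE ji)/= sub0r mulrC.
by rewrite -[in Theta j i]Ts mxE.
Qed.

Let supp_wstar : supp wstar = N.
Proof.
apply/setP => j; rewrite !inE.
have [->|ji] := eqVneq j i; first by rewrite wstar_i eqxx.
by rewrite wstarE// oppr_eq0 mulf_eq0 invr_eq0 (gt_eqF (T_gt0 i)) orbF.
Qed.

Let supp_ustar : supp ustar \subset i |: N.
Proof.
have -> : ustar = delta_mx i 0 - wstar by rewrite subKr.
apply/fintype.subsetP => j; rewrite in_setU1 -supp_wstar !inE.
have [//|ji] := eqVneq j i.
by rewrite mxE [delta_mx _ _ _ _]mxE (negbTE ji)/= mxE add0r oppr_eq0.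
Qed.

(** Nondegeneracy bounds the square of [wstar j 0] below by [kappa ^+ 2 * Theta j j / Theta i i],
    and [sq_entry_le] divides by [Theta j j]. *)
Let missing_neighbor (j : 'I_n) (v : 'cV[R]_n) : j \in N -> v j 0 = wstar j 0 ->
  kappa ^+ 2 / Theta i i <= qform Sigma v.
Proof.
rewrite inE => /andP[ji Tij] vj.
have := sq_entry_le j v; rewrite vj wstarE// sqrrN => H.
have /andP[k0 _] := kappa01.
have Tp : 0 < Theta i i * Theta j j by rewrite mulr_gt0.
have := nondeg (_ : i != j) Tij; rewrite eq_sym => /(_ ji).
rewrite ler_pdivlMr ?sqrtr_gt0// => K.
have K2 : kappa ^+ 2 * (Theta i i * Theta j j) <= Theta i j ^+ 2.
  rewrite -[leRHS]real_normK ?num_real// -[X in _ * X](sqr_sqrtr (ltW Tp)) -exprMn.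
  by rewrite lerXn2r// nnegrE// mulr_ge0 ?sqrtr_ge0// ltW.
rewrite -(ler_pM2r (T_gt0 j)); apply: le_trans H.
rewrite -(ler_pM2r (exprn_gt0 2 (T_gt0 i))) expr_div_n divfK ?gt_eqF ?exprn_gt0//.
apply: le_trans K2; rewrite le_eqVlt; apply/orP; left; apply/eqP.
by field; rewrite gt_eqF.
Qed.

Variable D : 'M[R]_(k, n).
(** The vectors tested are supported on [i] and at most [2 * deg] other indices, hence the sparsity
    level. *)
Hypothesis rip : forall v : 'cV[R]_n, (#|supp v| <= deg.*2.+1)%N ->
  `|qform (D^T *m D) v - k%:R * qform Sigma v| <= kappa / 20 * k%:R * qform Sigma v.

(** The population residual variance of node [i]; next, the residual sum of squares of the
    population weights on [D]. *)
Let s2 : R := (Theta i i)^-1.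
Let a : R := qform (D^T *m D) ustar.

Let s2_gt0 : 0 < s2. Proof. by rewrite invr_gt0. Qed.

Let G : 'M[R]_n := D^T *m D.
Let Gs : G^T = G. Proof. by rewrite trmx_mul trmxK. Qed.

(** In the expansion of the square, the term in [v] alone keeps [19 / 20] of [k * qform Sigma v];
    the cross term is pure sampling error because [v] is [Sigma]-orthogonal to [ustar]. *)
Let lower (v : 'cV[R]_n) : v i 0 = 0 -> (#|N :|: supp v| <= deg.*2)%N ->
  a + k%:R * (9 / 10 * qform Sigma v - kappa ^+ 2 / 20 * s2) <= qform G (ustar + v).
Proof.
move=> vi vN; have /andP[k0 k1] := kappa01.
have card_supp u : supp u \subset i |: (N :|: supp v) -> (#|supp u| <= deg.*2.+1)%N.
  move=> /subset_leq_card us; apply: (leq_trans us); rewrite cardsU1.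
  by rewrite -add1n leq_add// leq_b1.
pose M := G - k%:R *: Sigma.
have ME u : qform M u = qform G u - k%:R * qform Sigma u.
  by rewrite /qform /M mulmxBr mulmxBl mxE [X in _ + X]mxE -scalemxAr -scalemxAl [X in _ - X]mxE.
have Ms : M^T = M by rewrite /M raddfB/= linearZ/= Gs Ss.
have MB : bform M ustar v = bform G ustar v.
  rewrite /bform /M mulmxBr mulmxBl mxE [X in _ + X]mxE -scalemxAr -scalemxAl [X in _ - X]mxE.
  by rewrite -/(bform Sigma ustar v) bform_ustar vi mul0r mulr0 subr0.
(* The weight [kappa] brings the error in [s2] down to order [kappa ^+ 2], that of the signal to be
   detected, while the error in [v] costs only [1 / 20]. *)
have := @bform_le_scale _ _ M Sigma (kappa / 20 * k%:R) kappa ustar v Ms Ss k0.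
rewrite MB qform_ustar -/s2 => cross.
have {}cross : 2 * `|bform G ustar v| <= kappa / 20 * k%:R * (kappa * s2 + kappa^-1 * qform Sigma v).
  apply: cross => c; rewrite ME; apply: rip; apply: card_supp; apply/fintype.subsetP => j.
  rewrite inE !mxE in_setU1 finset.in_setU; apply: contraR; rewrite !negb_or => /and3P[ji jN jv].
  have := contra (fintype.subsetP supp_ustar j); rewrite in_setU1 negb_or ji jN => /(_ isT).
  by move: jv; rewrite !inE !negbK !mxE => /eqP -> /eqP ->; rewrite mulr0 addr0.
have diag : `|qform G v - k%:R * qform Sigma v| <= kappa / 20 * k%:R * qform Sigma v.
  by apply/rip/card_supp; apply/fintype.subsetP => j jv; rewrite in_setU1 finset.in_setU jv !orbT.
rewrite qformD// -/G.
have q0 := q_ge0 v; pose q : R := qform Sigma v; rewrite -[qform G ustar]/a -/q in q0 cross diag *.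
have kR : 0 <= k%:R :> R by rewrite ler0n.
have E : kappa / 20 * k%:R * (kappa * s2 + kappa^-1 * q) =
    k%:R * (kappa ^+ 2 / 20 * s2 + q / 20) by field; rewrite gt_eqF.
have kq : 0 <= k%:R * q by rewrite mulr_ge0.
have D1 : kappa / 20 * k%:R * q <= k%:R * q / 20.
  have := ler_wpM2r kq k1; lra.
move: cross diag; rewrite E => cross /ler_normlP[diag _].
have : - `|bform G ustar v| <= bform G ustar v by rewrite lerNl -normrN ler_norm.
by lra.
Qed.

Let rssE (w : 'cV[R]_n) : rss D i w = qform G (ustar + (wstar - w)).
Proof. by rewrite rss_qform /regression addrA subrKC. Qed.

Let rss_wstar : rss D i wstar = a.
Proof. by rewrite rssE subrr addr0. Qed.

Let lower_rss (w : 'cV[R]_n) : w i 0 = 0 -> (#|N :|: supp w| <= deg.*2)%N ->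
  a + k%:R * (9 / 10 * qform Sigma (wstar - w) - kappa ^+ 2 / 20 * s2) <= rss D i w.
Proof.
move=> wi wN; rewrite rssE; apply: lower; first by rewrite mxE wstar_i add0r mxE wi oppr0.
apply: leq_trans wN; apply/subset_leq_card/fintype.subsetP => l.
rewrite !finset.in_setU -supp_wstar; have [//|lN] := boolP (l \in supp wstar).
have e : (wstar - w) l 0 = wstar l 0 - w l 0 by rewrite [LHS]mxE [X in _ + X]mxE.
by move: lN; rewrite !inE negbK e => /eqP ->; rewrite sub0r oppr_eq0.
Qed.

(** By [missing_neighbor] the signal absorbs the error: [9 / 10 - 1 / 20 = 17 / 20]. *)
Let lower_missing (j : 'I_n) (w : 'cV[R]_n) : w i 0 = 0 -> (#|N :|: supp w| <= deg.*2)%N ->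
  j \in N -> j \notin supp w -> a + k%:R * (17 / 20 * (kappa ^+ 2 * s2)) <= rss D i w.
Proof.
move=> wi wN jN jw; apply: le_trans (lower_rss wi wN).
have wj : w j 0 = 0 by move: jw; rewrite inE negbK => /eqP.
have vj : (wstar - w) j 0 = wstar j 0 by rewrite mxE [X in _ + X]mxE wj subr0.
have := missing_neighbor jN vj; rewrite -/s2 => H.
by rewrite lerD2l ler_wpM2l// ?ler0n//; lra.
Qed.

Let lower_all (w : 'cV[R]_n) : w i 0 = 0 -> (#|N :|: supp w| <= deg.*2)%N ->
  a - k%:R * (kappa ^+ 2 / 20 * s2) <= rss D i w.
Proof.
move=> wi wN; apply: le_trans (lower_rss wi wN); rewrite -mulrN lerD2l ler_wpM2l//.
by have := q_ge0 (wstar - w); lra.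
Qed.

Hypothesis k_gt0 : (0 < k)%N.

(** [wstar] is feasible with residual sum [a], and a support that omits a neighbor does strictly
    worse; so the support contains [N], and the size constraint gives equality. *)
Lemma best_subset_neighbors (w : 'cV[R]_n) : best_subset D i #|N| w -> supp w = N.
Proof.
move=> [[wi wN] wmin].
have wstarF : feasible i #|N| wstar by split; rewrite ?wstar_i ?supp_wstar.
have := wmin _ wstarF; rewrite ler_pM2l ?invr_gt0 ?ltr0n// rss_wstar => wa.
apply/esym/eqP; rewrite eqEcard wN andbT; apply/fintype.subsetP => j jN.
apply/negPn/negP => jw; have /andP[k0 _] := kappa01.
have wN2 : (#|N :|: supp w| <= deg.*2)%N.
  rewrite -addnn; apply: (leq_trans (leq_card_setU _ _)).
  by rewrite leq_add// (leq_trans wN).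
have := le_trans (lower_missing wi wN2 jN jw) wa.
apply/negP; rewrite -ltNge ltrDl; apply: mulr_gt0; first by rewrite ltr0n.
by rewrite !mulr_gt0 ?exprn_gt0// ?invr_gt0// ltr0n.
Qed.

(** The first bound keeps the degrees of freedom at least [k / 2]; the second makes the effect of
    the changing denominators, of relative order [1 / k], small against [kappa ^+ 2]. *)
Hypotheses (k_deg : (4 * deg <= k)%N) (k_kappa : 16 <= kappa ^+ 2 * k%:R).

Let a_bounds : 19 / 20 * (k%:R * s2) <= a <= 21 / 20 * (k%:R * s2).
Proof.
have /andP[k0 k1] := kappa01.
have u1 : (#|supp ustar| <= deg.*2.+1)%N.
  apply: (leq_trans (subset_leq_card supp_ustar)); rewrite cardsU1 -add1n leq_add ?leq_b1//.
  by rewrite -addnn (leq_trans degN)// leq_addr.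
have := rip u1; rewrite qform_ustar -/s2 -/a => /ler_normlP[H1 H2].
have ks : 0 <= k%:R * s2 by rewrite mulr_ge0// ltW.
have := ler_wpM2r ks k1.
by move: H1 H2; lra.
Qed.

Section validation.
Variable S : {set 'I_n}.
Hypotheses (NS : N \subset S) (iS : i \notin S) (Sdeg : (#|S| <= deg.*2)%N).

Let sub_feasible (w : 'cV[R]_n) : supp w \subset S ->
  w i 0 = 0 /\ (#|N :|: supp w| <= deg.*2)%N.
Proof.
move=> wS; split; last first.
  by apply: leq_trans Sdeg; apply: subset_leq_card; rewrite finset.subUset NS.
apply/eqP; apply: contraNT iS => wi; apply: (fintype.subsetP wS).
by rewrite inE.
Qed.

Let M : R := k%:R - #|S|%:R.

Let M_ge : k%:R / 2 <= M.
Proof.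
have : (#|S|%:R : R) * 2 <= k%:R.
  rewrite -natrM ler_nat; apply: leq_trans k_deg.
  by rewrite mulnC (_ : 4 * deg = 2 * deg.*2)%N ?leq_mul2l// -mul2n mulnA.
by rewrite /M; lra.
Qed.

Let M_gt0 : 0 < M.
Proof. by apply: lt_le_trans M_ge; rewrite divr_gt0// ltr0n. Qed.

Let subD1 (j : 'I_n) : j \in S -> k%:R - #|S :\ j|%:R = M + 1 :> R.
Proof. by move=> jS; rewrite /M (cardsD1 j S) jS natrD/=; ring. Qed.

Let m (S : {set 'I_n}) := inf [set rss D i w | w in [set w : 'cV[R]_n | supp w \subset S]].

Let mS_le : m S <= a.
Proof. by rewrite -rss_wstar; apply: ols_var_inf_le; rewrite supp_wstar. Qed.

Lemma ols_var_gap (j : 'I_n) : j \in N ->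
  ols_var D i (S :\ j) - ols_var D i S > kappa ^+ 2 / 2 * ols_var D i S.
Proof.
move=> jN; have jS := fintype.subsetP NS _ jN; have /andP[k0 k1] := kappa01.
have mj : a + k%:R * (17 / 20 * (kappa ^+ 2 * s2)) <= m (S :\ j).
  apply: ols_var_inf_ge => w wS.
  have [wi wN] := sub_feasible (fintype.subset_trans wS (subD1set _ _)).
  apply: (@lower_missing j) => //; apply/negP => jw.
  by have := fintype.subsetP wS _ jw; rewrite !inE eqxx.
rewrite /ols_var subD1// -/M -/(m S) -/(m (S :\ j)).
have M1 : 0 < M + 1 by rewrite ltr_wpDr.
rewrite -(ltr_pM2l (mulr_gt0 M_gt0 M1)).
have -> : M * (M + 1) * (kappa ^+ 2 / 2 * (M^-1 * m S)) = kappa ^+ 2 / 2 * (M + 1) * m S.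
  by field; rewrite gt_eqF.
have -> : M * (M + 1) * ((M + 1)^-1 * m (S :\ j) - M^-1 * m S) = M * m (S :\ j) - (M + 1) * m S.
  by field; rewrite !gt_eqF.
have /andP[a1 a2] := a_bounds.
have Mk := M_ge; have Mp := M_gt0; have mSa := mS_le.
have kk := k_kappa; pose K := kappa ^+ 2; rewrite -/K in mj kk *.
have K0 : 0 < K by rewrite exprn_gt0.
have K1 : K <= 1 by rewrite exprn_ile1// ltW.
pose b := k%:R * s2.
have b0 : 0 < b by rewrite mulr_gt0// ltr0n.
rewrite -/b in a1 a2.
have KM : 8 <= K * M by have := ler_wpM2l (ltW K0) Mk; lra.
(* In units of [K * M * a], a missing neighbor gains at least [17 / 21], the threshold takes
   [1 / 2], and the remaining [a + K / 2 * a] is at most [3 / 16] because [K * M >= 8] and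
   [K <= 1]. *)
have h1 : (M + 1 + K / 2 * (M + 1)) * m S <= (M + 1 + K / 2 * (M + 1)) * a.
  by apply: ler_wpM2l => //; nra.
have h2 : M * (a + 17 / 20 * K * b) <= M * m (S :\ j).
  by apply: ler_wpM2l; [exact: ltW|apply: le_trans mj; rewrite /b; lra].
have h3 : K * M * a <= K * M * (21 / 20 * b) by apply: ler_wpM2l => //; lra.
have a0 : 0 < a by lra.
have h4 : K * a <= a by rewrite ler_piMl// ltW.
have h5 : 8 * a <= K * M * a by apply: ler_wpM2r => //; exact: ltW.
have h6 : K * M * (19 / 20 * b) <= K * M * a by apply: ler_wpM2l => //; lra.
lra.
Qed.

(** Both index sets contain [N]: [wstar] bounds the larger minimum by [a], and [lower_all] keeps the
    smaller one close to [a]. *)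
Lemma ols_var_nogap (j : 'I_n) : j \in S -> j \notin N ->
  ols_var D i (S :\ j) - ols_var D i S <= kappa ^+ 2 / 2 * ols_var D i S.
Proof.
move=> jS jN; have /andP[k0 k1] := kappa01.
have mj : m (S :\ j) <= a.
  rewrite -rss_wstar; apply: ols_var_inf_le; rewrite supp_wstar.
  by rewrite subsetD1 NS.
have mS : a - k%:R * (kappa ^+ 2 / 20 * s2) <= m S.
  by apply: ols_var_inf_ge => w wS; have [wi wN] := sub_feasible wS; exact: lower_all.
rewrite /ols_var subD1// -/M -/(m S) -/(m (S :\ j)).
have M1 : 0 < M + 1 by rewrite ltr_wpDr.
rewrite -(ler_pM2l (mulr_gt0 M_gt0 M1)).
have -> : M * (M + 1) * (kappa ^+ 2 / 2 * (M^-1 * m S)) = kappa ^+ 2 / 2 * (M + 1) * m S.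
  by field; rewrite gt_eqF.
have -> : M * (M + 1) * ((M + 1)^-1 * m (S :\ j) - M^-1 * m S) = M * m (S :\ j) - (M + 1) * m S.
  by field; rewrite !gt_eqF.
have /andP[a1 a2] := a_bounds.
have Mk := M_ge; have Mp := M_gt0.
have kk := k_kappa; pose K := kappa ^+ 2; rewrite -/K in mS kk *.
have K0 : 0 < K by rewrite exprn_gt0.
have K1 : K <= 1 by rewrite exprn_ile1// ltW.
pose b := k%:R * s2; have b0 : 0 < b by rewrite mulr_gt0// ltr0n.
rewrite -/b in a1 a2.
have h1 : M * m (S :\ j) <= M * a by apply: ler_wpM2l => //; exact: ltW.
have h2 : (M + 1) * (1 + K / 2) * (a - K / 20 * b) <= (M + 1) * (1 + K / 2) * m S.
  by apply: ler_wpM2l; [nra|rewrite /b; lra].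
(* The slack [K / 2 * a], at least [19 / 40 * K * b], exceeds the loss
   [K / 20 * b + K ^+ 2 / 40 * b]. *)
have h3 : a <= (1 + K / 2) * (a - K / 20 * b).
  have : K * K * b <= K * b by rewrite -mulrA ler_piMl// mulr_ge0// ltW.
  have : K * (19 / 20 * b) <= K * a by apply: ler_wpM2l => //; exact: ltW.
  have : 0 < K * b by exact: mulr_gt0.
  lra.
have h4 : (M + 1) * a <= (M + 1) * ((1 + K / 2) * (a - K / 20 * b)).
  by apply: ler_wpM2l => //; exact: ltW.
have a0 : 0 < a by lra.
lra.
Qed.

End validation.

End recovery.

(** The candidate of size [#|N|] is [N] and passes: its union with another support contains [N], and
    the indices tested lie outside [N]. A smaller candidate misses a neighbor and is rejected by
    comparison with this one, which is therefore the first to pass. *)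
Lemma search_and_validate_correct (R : realType) (k1 k2 n : nat)
    (D1 : 'M[R]_(k1, n)) (D2 : 'M[R]_(k2, n)) (i : 'I_n) (deg : nat) (nu : R)
    (N : {set 'I_n}) :
  (#|N| <= deg)%N -> i \notin N ->
  (forall w, best_subset D1 i #|N| w -> supp w = N) ->
  (forall S : {set 'I_n}, N \subset S -> i \notin S -> (#|S| <= deg.*2)%N ->
    forall j, j \in N -> ols_var D2 i (S :\ j) - ols_var D2 i S > nu * ols_var D2 i S) ->
  (forall S : {set 'I_n}, N \subset S -> i \notin S -> (#|S| <= deg.*2)%N ->
    forall j, j \in S -> j \notin N ->
    ols_var D2 i (S :\ j) - ols_var D2 i S <= nu * ols_var D2 i S) ->
  forall out, search_and_validate D1 D2 i deg nu out <-> out = Some N.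
Proof.
move=> Ndeg iN best gap nogap out.
pose t : 'I_deg.+1 := Ordinal (Ndeg : (#|N| < deg.+1)%N).
suff H (w : 'I_deg.+1 -> 'cV[R]_n) : (forall s : 'I_deg.+1, best_subset D1 i s (w s)) ->
    validate D2 i nu w = Some N.
  split=> [[w [wb ->]]|->]; first exact: H.
  have /choice[w wb] := fun s : 'I_deg.+1 => best_subset_exists D1 i s.
  by exists w; split => //; rewrite H.
move=> wb; have wtN : supp (w t) = N by apply: best; exact: (wb t).
have iw s : i \notin supp (w s) by have [[wi _] _] := wb s; rewrite inE negbK wi.
have ws s : (#|supp (w s)| <= s)%N by have [[_ ?] _] := wb s.
have cardU d1 : (#|supp (w d1) :|: N| <= deg.*2)%N.
  rewrite -addnn; apply: (leq_trans (leq_card_setU _ _)); rewrite leq_add//.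
  by apply: (leq_trans (ws d1)); rewrite -ltnS.
rewrite -wtN; apply: validate_first.
  apply/existsP => -[d2 /andP[_ /existsP[j /andP[]]]].
  rewrite finset.in_setD wtN => /andP[jN jw].
  apply/negP; rewrite -leNgt finset.setUC.
  by apply: nogap => //; rewrite ?finset.subsetUr ?finset.in_setU ?jw ?negb_or ?iw.
move=> d1 d1t; apply/existsP; exists t; rewrite -val_eqE gtn_eqF//=.
have /subsetPn[j jN jw] : ~~ (N \subset supp (w d1)).
  apply/negP => /subset_leq_card; rewrite leqNgt.
  by rewrite (leq_ltn_trans (ws d1)).
apply/existsP; exists j; rewrite finset.in_setD jw wtN jN/=.
by apply: gap => //; rewrite ?finset.subsetUr ?finset.in_setU ?negb_or ?iw.
Qed.

Section sample_sets.
Context {R : realType} (d : measure_display) (T : measurableType d)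
  (P : probability T R) (n k : nat) (X : 'I_(k + k) -> {RV P >-> n.-tuple R}).

Lemma scatter_sample_set1 (w : T) : (sample_set1 (X ^~ w))^T *m sample_set1 (X ^~ w) =
  scatter X [pred s : 'I_(k + k) | (s < k)%N] w.
Proof.
apply/matrixP => a b; rewrite mxE /scatter summxE big_split_ord/= [X in _ = _ + X]big_pred0 ?addr0.
  rewrite [RHS]big_mkcond/=; apply: eq_bigr => r _; rewrite ltn_ord !mxE big_ord1 !mxE.
  by [].
by move=> r; rewrite ltnNge leq_addr.
Qed.

Lemma scatter_sample_set2 (w : T) : (sample_set2 (X ^~ w))^T *m sample_set2 (X ^~ w) =
  scatter X [pred s : 'I_(k + k) | (k <= s)%N] w.
Proof.
apply/matrixP => a b; rewrite mxE /scatter summxE big_split_ord/= [X in _ = X + _]big_pred0 ?add0r.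
  rewrite [RHS]big_mkcond/=; apply: eq_bigr => r _; rewrite leq_addr !mxE big_ord1 !mxE.
  by [].
by move=> r; rewrite leqNgt ltn_ord.
Qed.

Lemma card_sample_set1 : #|[pred s : 'I_(k + k) | (s < k)%N]| = k.
Proof.
rewrite -sum1_card big_split_ord/= [X in (_ + X)%N]big_pred0 ?addn0.
  by rewrite (eq_bigl xpredT) ?sum1_card ?card_ord// => r; rewrite inE/= ltn_ord.
by move=> r; rewrite inE/= ltnNge leq_addr.
Qed.

Lemma card_sample_set2 : #|[pred s : 'I_(k + k) | (k <= s)%N]| = k.
Proof.
rewrite -sum1_card big_split_ord/= big_pred0 ?add0n.
  by rewrite (eq_bigl xpredT) ?sum1_card ?card_ord// => r; rewrite inE/= leq_addr.
by move=> r; rewrite inE/= leqNgt ltn_ord.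
Qed.

End sample_sets.

(** * Sample size and probability of failure *)

Lemma ln2_ge (R : realType) : 2^-1 <= ln 2 :> R.
Proof.
rewrite -ler_expR lnK ?posrE// -[expR _]invrK -expRN invf_ple ?posrE ?expR_gt0//.
by apply: le_trans (expR_ge1Dx _); lra.
Qed.

Lemma max_degree_gt0 (R : realType) (n : nat) (Theta : 'M[R]_n) :
  (0 < max_degree Theta)%N -> (1 < n)%N.
Proof.
move=> dg; rewrite ltnNge; apply/negP => n1; move: dg; rewrite lt0n => /negP; apply.
rewrite -leqn0; apply/bigmax_leqP => i _; rewrite leqn0 cards_eq0.
apply/eqP/setP => j; rewrite !inE.
have -> : j = i.
  apply: val_inj; have := leq_trans (ltn_ord i) n1; have := leq_trans (ltn_ord j) n1.
  by rewrite !ltnS !leqn0 => /eqP j0 /eqP i0; rewrite /= j0 i0.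
by rewrite eqxx.
Qed.

Theorem theorem12 (R : realType) :
  exists C : R, 0 < C /\
  forall (delta kappa : R) (n deg k : nat) (Sigma : 'M[R]_n)
    (disp : measure_display) (T : measurableType disp) (P : probability T R)
    (X : 'I_(k + k) -> {RV P >-> n.-tuple R}),
    0 < delta < 1 ->
    0 < kappa <= 1 ->
    Sigma \in unitmx ->
    kappa_nondegenerate kappa (invmx Sigma) ->
    max_degree (invmx Sigma) = deg ->
    (forall s, gaussian_vector (X s) Sigma) ->
    mutually_independent X ->
    C * (deg%:R * ln n%:R / kappa ^+ 2 + ln (2 / delta) / kappa ^+ 2)
      <= (k + k)%:R ->
    exists E : set T,
      [/\ measurable E,
          ((1 - delta)%:E <= P E)%E
        & forall omega, E omega ->
          forall (i : 'I_n) (out : option {set 'I_n}),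
            search_and_validate (sample_set1 (X ^~ omega))
              (sample_set2 (X ^~ omega)) i deg (kappa ^+ 2 / 2) out <->
            out = Some (neighbors (invmx Sigma) i)].
Proof.
(* The factor 2 passes from [k] to [k + k] samples, [60 * 60 * 40] comes from the tail exponent
   [eta ^+ 2 / 40] at [eta = kappa / 60], and [57 = 19 * 3] from the size of the union bound. *)
pose C : R := 2 * 57 * 60 * 60 * 40.
have C0 : 0 < C by rewrite /C; lra.
exists C; split => //.
move=> delta kappa n deg k Sigma disp T P X /andP[d0 d1] kappa01 Su nondeg maxdeg gX iX mC.
set Theta := invmx Sigma in nondeg maxdeg *.
have degN i : (#|neighbors Theta i| <= deg)%N.
  by rewrite -maxdeg; exact: (leq_bigmax (F := fun i => #|neighbors Theta i|)).
have iN i : i \notin neighbors Theta i by rewrite inE eqxx.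
(* Without edges the only candidate is the empty set, whatever the data. A positive degree forces
   [n >= 2], hence the lower bound on [ln n] used below. *)
have [deg0|deg_gt0] := posnP deg.
  exists setT; split; first exact: measurableT.
    by rewrite probability_setT lee_fin; lra.
  move=> w _ i; have N0 : neighbors Theta i = finset.set0.
    by apply/eqP; rewrite -cards_eq0 -leqn0 -deg0.
  apply: search_and_validate_correct; rewrite ?N0 ?cards0 ?inE// ?deg0.
  - by move=> v [[_ ]]; rewrite leqn0 cards_eq0 => /eqP ->.
  - by move=> S _ _ _ j; rewrite inE.
  - by move=> S _ _; rewrite leqn0 cards_eq0 => /eqP -> j; rewrite inE.
have n1 : (1 < n)%N by apply: (@max_degree_gt0 R n Theta); rewrite maxdeg.
have /andP[k0 k1] := kappa01.
pose K := kappa ^+ 2; have K0 : 0 < K by rewrite exprn_gt0.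
have K1 : K <= 1 by rewrite exprn_ile1// ltW.
pose L := ln (2 / delta).
pose l := deg%:R * ln n%:R : R.
have L0 : 0 < L.
  by rewrite ln_gt0// ltr_pdivlMr// mul1r; lra.
have lnn : 2^-1 <= ln n%:R :> R.
  by apply: (le_trans (ln2_ge R)); rewrite ler_ln ?posrE ?ltr0n ?ler_nat// (ltn_trans _ n1).
have ldeg : deg%:R / 2 <= l by rewrite /l ler_wpM2l.
have deg1 : 1 <= deg%:R :> R by rewrite ler1n.
have kC : C / 2 * (l + L) <= K * k%:R.
  move: mC; rewrite -mulrDl -/l -/L -/K mulrA ler_pdivrMr// natrD; lra.
have kK : K * k%:R <= k%:R by rewrite ler_piMl.
have kdeg : (4 * deg <= k)%N.
  by rewrite -(ler_nat R) natrM; rewrite /C in kC; lra.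
have kgt0 : (0 < k)%N by rewrite (leq_trans _ kdeg)// muln_gt0.
have k16 : 16 <= kappa ^+ 2 * k%:R by rewrite -/K; rewrite /C in kC; lra.
have [A [Z [AS _ _ _]]] := gX (lshift k (Ordinal kgt0)).
have Au : A \in unitmx by move: Su; rewrite -AS unitmx_mul => /andP[].
(* [net_bound] costs a factor 3, which turns [kappa / 60] into the [kappa / 20] of the isometry. *)
pose eta := kappa / 60.
have eta01 : 0 <= eta <= 1 by rewrite /eta; lra.
pose p := deg.*2.+1.
have n0 : (0 < n)%N by rewrite (ltn_trans _ n1).
have [E1 [mE1 PE1 ripE1]] := @rip_sparse _ _ _ P n _ X Sigma iX gX
  [pred s : 'I_(k + k) | (s < k)%N] eta eta01 A p n0 AS Au.
have [E2 [mE2 PE2 ripE2]] := @rip_sparse _ _ _ P n _ X Sigma iX gX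
  [pred s : 'I_(k + k) | (k <= s)%N] eta eta01 A p n0 AS Au.
rewrite card_sample_set1 in PE1 ripE1; rewrite card_sample_set2 in PE2 ripE2.
have tail : n%:R ^+ p * (2 ^+ (18 * p) * (2 * expR (- (k%:R * eta ^+ 2 / 40)))) <= delta / 2 :> R.
  have d2 : 0 < delta / 2 by lra.
  rewrite -(lnK (_ : delta / 2 \in Num.pos)) ?posrE//.
  have -> : ln (delta / 2) = - L.
    by rewrite /L -lnV ?posrE ?divr_gt0// invf_div.
  have nE : n%:R = expR (ln n%:R) :> R by rewrite lnK// posrE ltr0n.
  have p3 : (p <= 3 * deg)%N by rewrite mulSn mul2n /p -add1n leq_add2r.
  have lnn0 : 0 <= ln n%:R :> R by lra.
  (* As [n >= 2], the powers of 2 are absorbed into [n ^ (19 * p)], and [19 * p <= 57 * deg]. *)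
  have step1 : n%:R ^+ p * 2 ^+ (18 * p) <= expR (57 * l) :> R.
    apply: (@le_trans _ _ (n%:R ^+ (19 * p))).
      by rewrite (mulSn 18 p) exprD ler_wpM2l ?exprn_ge0// lerXn2r ?nnegrE// ler_nat.
    rewrite {1}nE -expRM_natl ler_expR /l mulrA ler_wpM2r//.
    by move: p3; rewrite -(ler_nat R) !natrM => ?; lra.
  (* One [expR L] pays for the factor 2 of the two-sided tail; the target [delta / 2] takes
     another. *)
  have step2 : 2 <= expR L by rewrite /L lnK ?posrE ?divr_gt0// ler_pdivlMr//; lra.
  have eE : k%:R * eta ^+ 2 / 40 = K * k%:R / (60 * 60 * 40) by rewrite /eta /K; field.
  rewrite mulrA.
  apply: (@le_trans _ _ (expR (57 * l) * (expR L * expR (- (K * k%:R / (60 * 60 * 40)))))).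
    rewrite eE; apply: ler_pM => //.
    by rewrite ler_wpM2r// expR_ge0.
  by rewrite -!expRD ler_expR; rewrite /C in kC; lra.
exists (~` (E1 `|` E2)); split.
- by apply: measurableC; exact: measurableU.
- rewrite probability_setC; last exact: measurableU.
  rewrite EFinB leeB//; apply: (le_trans (measureU2 P mE1 mE2)).
  apply: (@le_trans _ _ ((delta / 2)%:E + (delta / 2)%:E)%E).
    by apply: leeD; [apply: (le_trans PE1)|apply: (le_trans PE2)]; rewrite lee_fin.
  by rewrite -EFinD lee_fin; lra.
move=> w; rewrite setCU => -[wE1 wE2] i.
have eE : 3 * eta * k%:R = kappa / 20 * k%:R by rewrite /eta; field.
have rip1 (v : 'cV[R]_n) : (#|supp v| <= p)%N ->
    `|qform ((sample_set1 (X ^~ w))^T *m sample_set1 (X ^~ w)) v - k%:R * qform (A *m A^T) v|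
      <= kappa / 20 * k%:R * qform (A *m A^T) v.
  by rewrite scatter_sample_set1 AS -eE; exact: ripE1.
have rip2 (v : 'cV[R]_n) : (#|supp v| <= p)%N ->
    `|qform ((sample_set2 (X ^~ w))^T *m sample_set2 (X ^~ w)) v - k%:R * qform (A *m A^T) v|
      <= kappa / 20 * k%:R * qform (A *m A^T) v.
  by rewrite scatter_sample_set2 AS -eE; exact: ripE2.
rewrite /Theta -AS in nondeg degN iN *.
apply: search_and_validate_correct => //.
- by move=> v; exact: (best_subset_neighbors Au kappa01 nondeg (degN i) rip1 kgt0).
- move=> S NS iS Sd j jN.
  exact: (ols_var_gap Au kappa01 nondeg (degN i) rip2 kgt0 kdeg k16 NS iS Sd jN).
- move=> S NS iS Sd j jS jN.
  exact: (ols_var_nogap Au kappa01 (degN i) rip2 kgt0 kdeg k16 NS iS Sd jS jN).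
Qed.
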